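(* Let $p$ be an odd prime, $P$ a finite $p$-group of class $2$ and exponent $p$, and $\mathcal{H}$ a fully refined central decomposition of $P$. Let $Z(\mathcal{H})=\{H\in\mathcal{H}: H\le Z(P)\}$, $\mathcal{K}=\mathcal{H}-Z(\mathcal{H})$, $Q=\langle\mathcal{K}\rangle$, $b=\mathsf{Bi}(Q)$ and $A=\operatorname{Adj}(b)$. For each maximal $*$-ideal $I$ of $A$ let $\mathcal{K}_I=\{H\in\mathcal{K}: e_H\notin I\}$. Then $\mathcal{H}$ is partitioned into $Z(\mathcal{H})$ together with the sets $\mathcal{K}_I$, $I$ ranging over the maximal $*$-ideals of $A$. Furthermore $|Z(\mathcal{H})|$, $|\mathcal{K}|$ and $|\mathcal{H}|$ are uniquely determined by $P$ (i.e. are the same for all fully refined central decompositions of $P$).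
   Context: A central decomposition of $P$ is a set of subgroups, pairwise commuting elementwise, generating $P$, with no proper subset generating $P$; fully refined means each member is centrally indecomposable (has only the trivial central decomposition). $\mathsf{Bi}(Q)$ is the alternating $\mathbb{Z}_p$-bilinear map $Q/Q'\times Q/Q'\to Q'$, $(Q'x,Q'y)\mapsto[x,y]$ (here $Q'=Z(Q)$, so it is non-degenerate). $\operatorname{Adj}(b)$ is the $*$-algebra of $f\in\operatorname{End}(Q/Q')$ having an adjoint $f^*$ with $b(uf,v)=b(u,vf^* )$ for all $u,v$. A $*$-ideal is a two-sided ideal $I$ with $I^*=I$; maximal $*$-ideals are maximal among proper $*$-ideals. The subspaces $HQ'/Q'$ ($H\in\mathcal{K}$) form a direct decomposition of $Q/Q'$, and $e_H\in\operatorname{End}(Q/Q')$ is the projection onto $HQ'/Q'$ along the sum of the other $KQ'/Q'$, $K\in\mathcal{K}$; each $e_H$ lies in $\operatorname{Adj}(b)$. *)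

(* Defs.v *)
From HB Require Import structures.
From mathcomp Require Import all_boot all_fingroup all_solvable.

Set Implicit Arguments.
Unset Strict Implicit.
Unset Printing Implicit Defensive.

Local Open Scope group_scope.

Section CentralDecomposition.
Variable gT : finGroupType.

Definition gen_of (S : {set {group gT}}) : {set gT} := <<\bigcup_(X in S) X>>.

Definition central_decomp (G : {set gT}) (S : {set {group gT}}) : bool :=
  [&& gen_of S == G,
      [forall X in S, forall Y in S, (X != Y) ==> (X \subset 'C(Y))] &
      [forall S' : {set {group gT}}, (S' \proper S) ==> (gen_of S' != G)]].

Definition centrally_indecomposable (G : {group gT}) : bool :=
  [forall S : {set {group gT}}, central_decomp G S ==> (S == [set G])].

Definition fully_refined (G : {set gT}) (S : {set {group gT}}) : bool :=
  central_decomp G S && [forall X in S, centrally_indecomposable X].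

Definition Zpart (P : {set gT}) (S : {set {group gT}}) : {set {group gT}} :=
  [set X in S | X \subset 'Z(P)].
Definition Kpart (P : {set gT}) (S : {set {group gT}}) : {set {group gT}} :=
  S :\: Zpart P S.
Definition Qof (P : {set gT}) (S : {set {group gT}}) : {set gT} :=
  gen_of (Kpart P S).

End CentralDecomposition.

Section Adjoints.
Variables (gT : finGroupType) (Q : {set gT}).

Definition cosT := coset_of (Q^`(1)).
Definition Vq : {set cosT} := Q / Q^`(1).

Definition Bi (u v : cosT) : gT := [~ repr u, repr v].

(* End(Q/Q'): additive (= Z_p-linear) maps of Q/Q', encoded as finite
   functions that are trivial outside Q/Q'. *)
Definition endT := {ffun cosT -> cosT}.

Definition is_end (f : endT) : bool :=
  [&& [forall x in Vq, forall y in Vq, f (x * y) == f x * f y],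
      [forall x in Vq, f x \in Vq] &
      [forall x, (x \notin Vq) ==> (f x == 1)]].

Definition is_adjoint (f g : endT) : bool :=
  [&& is_end f, is_end g &
      [forall u in Vq, forall v in Vq, Bi (f u) v == Bi u (g v)]].

Definition Adj : {set endT} := [set f | is_end f && [exists g, is_adjoint f g]].

(* ring operations of End(Q/Q') (maps act on the right: u(fg) = (uf)g) *)
Definition zeroE : endT := [ffun _ => 1].
Definition addE (f g : endT) : endT := [ffun x => f x * g x].
Definition oppE (f : endT) : endT := [ffun x => (f x)^-1].
Definition mulE (f g : endT) : endT := [ffun x => g (f x)].

Definition is_ideal (I : {set endT}) : bool :=
  [&& I \subset Adj, zeroE \in I,
      [forall f in I, forall g in I, addE f g \in I],
      [forall f in I, oppE f \in I] &
      [forall a in Adj, forall f in I, (mulE a f \in I) && (mulE f a \in I)]].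

Definition is_star_ideal (I : {set endT}) : bool :=
  is_ideal I && [forall f in I, forall g, is_adjoint f g ==> (g \in I)].

Definition max_star_ideals : {set {set endT}} :=
  [set I | [&& is_star_ideal I, I != Adj &
     [forall J : {set endT},
        [&& is_star_ideal J, J != Adj & I \subset J] ==> (J == I)]]].

(* e_H: projection of Q/Q' onto HQ'/Q' along the sum of the KQ'/Q',
   K in Kfam, K <> H. *)
Definition is_proj (Kfam : {set {group gT}}) (H : {group gT}) (f : endT) : bool :=
  [&& is_end f, [forall u in H / Q^`(1), f u == u] &
      [forall K in Kfam, (K != H) ==> [forall u in K / Q^`(1), f u == 1]]].

Definition eproj (Kfam : {set {group gT}}) (H : {group gT}) : endT :=
  odflt zeroE [pick f | is_proj Kfam H f].

Definition Kset (Kfam : {set {group gT}}) (I : {set endT}) : {set {group gT}} :=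
  [set H in Kfam | eproj Kfam H \notin I].

End Adjoints.

Arguments Kset {gT} Q Kfam I.
Arguments eproj {gT} Q Kfam H.
Arguments max_star_ideals {gT} Q.
Arguments Adj {gT} Q.

(* Main.v *)
Require Import Defs.
From HB Require Import structures.
From mathcomp Require Import all_boot all_algebra all_fingroup all_solvable.

(* Write b for the commutator form on V = Q/Q', where Q' = Z(Q), and A for its
   ring of adjoints, a finite ring with involution * in which 2 is invertible.
   Members H of a decomposition correspond to pairwise orthogonal symmetric
   idempotents e_H of A with sum 1, and e_H is primitive among symmetric
   idempotents because H is centrally indecomposable.
   - Some maximal *-ideal misses e_H: a *-ideal I maximal among those missing
     e_H has a semiprime quotient, in which every nonzero *-ideal contains the
     image of e_H and is generated by a central idempotent, which must be 1.
   - Only one does: if I and J both miss e_H and 1 = i + j with i in I, j in J,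
     then some power of x s(x), for x = e_H i e_H, is an idempotent that splits
     e_H.
   - If e and f are primitive and outside I, then e = xy and f = yx for some
     x, y in A. In A/I, which is von Neumann regular, a symmetric nilpotent in
     the corner of e would give a hyperbolic pair and split e; hence the corner
     (e, f) contains x with x s(x) not nilpotent.
   So |A/I| is the |K_I|-th power of the size of a left ideal that depends only
   on I, and |K_I| is independent of the decomposition. A second decomposition
   of P is compared with the first by taking traces HZ(P) :&: Q. Finally
   |Z(P)| = |P'| p^k, where k is the number of central members. *)

Set Implicit Arguments.
Unset Strict Implicit.
Unset Printing Implicit Defensive.

(** * Finite rings with involution *)

Section StarRings.
Import GRing.Theory.
Local Open Scope ring_scope.

Record involution (R : pzRingType) := Involution {
  star_fun :> R -> R;
  starD : {morph star_fun : x y / x + y};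
  starM : forall x y, star_fun (x * y) = star_fun y * star_fun x;
  starK : involutive star_fun
}.

Section Involution.
Variables (R : pzRingType) (s : involution R).

Lemma star0 : s 0 = 0.
Proof. by apply: (addrI (s 0)); rewrite -starD !addr0. Qed.

Lemma starN x : s (- x) = - s x.
Proof. by apply: (addrI (s x)); rewrite -starD !subrr star0. Qed.

Lemma starB x y : s (x - y) = s x - s y.
Proof. by rewrite starD starN. Qed.

Lemma star1 : s 1 = 1.
Proof. by rewrite -[LHS]mulr1 -{2}[1](starK s) -starM mulr1 starK. Qed.

Lemma starX x n : s (x ^+ n) = s x ^+ n.
Proof. by elim: n => [|n IHn]; rewrite ?star1 // exprS starM IHn -exprSr. Qed.

Lemma starMn x n : s (x *+ n) = s x *+ n.
Proof. by elim: n => [|n IHn]; rewrite ?star0 // !mulrS starD IHn. Qed.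

Definition star_primitive (e : R) : Prop :=
  [/\ e <> 0, e * e = e, s e = e &
      forall g, g * g = g -> s g = g -> e * g = g -> g * e = g ->
        g = 0 \/ g = e].

End Involution.

(** * Von Neumann regular rings with involution in which [k] acts as one half *)

Section RegularRing.
Variables (R : pzRingType) (s : involution R) (k : nat).
Hypothesis two_k : k.*2%:R = 1 :> R.
Hypothesis regular : forall x : R, exists y, x * y * x = x.
Variable e : R.
Hypothesis prim_e : star_primitive s e.

Let half (x : R) : x *+ k + x *+ k = x.
Proof. by rewrite -mulrnDr addnn -mulr_natr two_k mulr1. Qed.

(* If x = at + ta is the identity e of the corner eRe, then a + t squares to e,
   so (e + a + t)/2 is a symmetric idempotent, which is neither 0 nor e. *)
Lemma hyperbolic_pair_eq0 a t :
    e * a = a -> a * e = a -> s a = a -> a * a = 0 ->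
    e * t = t -> t * e = t -> s t = t -> t * t = 0 ->
    a * t * a = a -> t * a * t = t -> a = 0.
Proof.
have [e_neq0 ee se e_prim] := prim_e.
move=> ea ae sa aa et te st tt ata tat.
have [||||x0|xe] := e_prim (a * t + t * a).
- rewrite !mulrDr !mulrDl !mulrA ata tat -!(mulrA _ a a) -!(mulrA _ t t) aa tt.
  by rewrite !mulr0 !mul0r add0r addr0.
- by rewrite starD !starM sa st addrC.
- by rewrite mulrDr !mulrA ea et.
- by rewrite mulrDl -!mulrA ae te.
- have : a * (a * t + t * a) = 0 by rewrite x0 mulr0.
  by rewrite mulrDr !mulrA aa mul0r add0r ata.
pose u := e + a + t.
have uu : u * u = u + u.
  rewrite {1}/u !mulrDl !mulrDr ee ea et ae aa te tt !addr0 /u -xe.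
  by rewrite -[LHS]addrA; congr (_ + _); rewrite [LHS]addrACA addrC addrA.
have [||||g0|ge] := e_prim (u *+ k).
- by rewrite mulrnAl mulrnAr uu mulrnDl half.
- by rewrite starMn !starD se sa st.
- by rewrite mulrnAr !mulrDr ee ea et.
- by rewrite mulrnAl !mulrDl ee ae te.
- have u0 : u = 0 by rewrite -(half u) g0 addr0.
  have : a * u * a = 0 by rewrite u0 mulr0 mul0r.
  by rewrite !mulrDr !mulrDl ae aa mul0r ata !add0r.
have : a * u * a = a * (e + e) * a by rewrite -ge half.
by rewrite !mulrDr !mulrDl ae aa mul0r ata !add0r.
Qed.

(** A quasi-inverse of [a] is compressed to the corner of [e] and symmetrised ([s1]), corrected so
    that [a * s2 * s2 * a = 0], and turned into [t = s2 * a * s2]. Then [a] and [t] form a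
    hyperbolic pair, and [hyperbolic_pair_eq0] applies. *)
Lemma symmetric_square0 a :
  e * a = a -> a * e = a -> s a = a -> a * a = 0 -> a = 0.
Proof.
have [e_neq0 ee se e_prim] := prim_e => ea ae sa aa.
have [r ara] := regular a.
pose s0 := e * r * e.
have as0a : a * s0 * a = a by rewrite !mulrA ae -!mulrA ea mulrA.
pose s1 := (s0 + s s0) *+ k.
have ss1 : s s1 = s1 by rewrite starMn starD starK addrC.
have es1 : e * s1 = s1 by rewrite /s1 /s0 mulrnAr mulrDr !starM se !mulrA ee.
have s1e : s1 * e = s1 by rewrite -ss1 -[in LHS]se -starM es1.
have as1a : a * s1 * a = a.
  rewrite mulrnAr mulrnAl mulrDr mulrDl as0a.
  have -> : a * s s0 * a = a by rewrite -[RHS]sa -[in RHS]as0a 2!starM sa mulrA.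
  by rewrite mulrnDl half.
clearbody s1.
pose c := a * s1 * s1 * a.
(* Since [a * a = 0], this lowers both [a * s1] and [s1 * a] by half of [c]. In the product
   [a * s2 * s2 * a] the two cross terms then cancel [c], and [c * c = 0]. *)
pose s2 := s1 - (s1 * s1 * a + a * s1 * s1) *+ k.
have ss2 : s s2 = s2.
  by rewrite starB starMn starD !starM ss1 sa !mulrA [X in X *+ k]addrC.
have es2 : e * s2 = s2 by rewrite mulrBr mulrnAr mulrDr !mulrA es1 ea.
have s2e : s2 * e = s2 by rewrite -ss2 -[in LHS]se -starM es2.
have as2 : a * s2 = a * s1 - c *+ k.
  by rewrite mulrBr mulrnAr mulrDr !mulrA aa !mul0r addr0.
have s2a : s2 * a = s1 * a - c *+ k.
  by rewrite -[LHS](starK s) starM ss2 sa as2 starB starMn !starM ss1 sa !mulrA.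
have ca : c * a = 0 by rewrite -mulrA aa mulr0.
have as2a : a * s2 * a = a by rewrite as2 mulrBl as1a mulrnAl ca mul0rn subr0.
have as2s2a : a * s2 * s2 * a = 0.
  rewrite -mulrA as2 s2a mulrBl !mulrBr !mulrnAl !mulrnAr !mulrA as1a.
  rewrite ca !mul0r !mul0rn subr0.
  have -> : c * s1 * a = c by rewrite /c -(mulrA _ a s1) -(mulrA _ _ a) as1a.
  by rewrite -/c -addrA -opprD half subrr.
pose t := s2 * a * s2.
apply: (@hyperbolic_pair_eq0 a t) => //.
- by rewrite !mulrA es2.
- by rewrite -mulrA s2e.
- by rewrite !starM sa ss2 mulrA.
- have -> : t * t = s2 * (a * s2 * s2 * a) * s2 by rewrite /t !mulrA.
  by rewrite as2s2a mulr0 mul0r.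
- by rewrite /t !mulrA as2a.
- have -> : t * a * t = s2 * (a * s2 * a) * s2 * a * s2 by rewrite /t !mulrA.
  by rewrite as2a -2!(mulrA s2) as2a.
Qed.

(** If [a ^+ m.+2 = 0], then [a ^+ m.+1] is symmetric of square zero, so it vanishes and the
    exponent drops by one. *)
Lemma symmetric_nilpotent a n :
  e * a = a -> a * e = a -> s a = a -> a ^+ n = 0 -> a = 0.
Proof.
move=> ea ae sa an0; elim: n {-2}n (leqnn n) an0 => [|n IHn] m le_mn am0.
  by move: le_mn am0; case: m => // _ am0; rewrite -[a]mul1r -(expr0 a) am0 mul0r.
case: m => [|[|m]] in le_mn am0 *.
- by rewrite -[a]mul1r -(expr0 a) am0 mul0r.
- by rewrite -am0 expr1.
apply: (IHn m.+1) => //; apply: symmetric_square0.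
- by rewrite exprS mulrA ea.
- by rewrite exprSr -mulrA ae.
- by rewrite starX sa.
- have -> : a ^+ m.+1 * a ^+ m.+1 = a ^+ m.+2 * a ^+ m.
    by rewrite -!exprD !addSn addnS.
  by rewrite am0 mul0r.
Qed.

(* Linearising x s(x) = 0 gives x s(y) = - y s(x), so for y chosen with
   x s(y) x = x the idempotent x s(y) is skew, hence 0. *)
Lemma isotropic_corner_eq0 f :
    f * f = f -> s f = f ->
    (forall x, e * x = x -> x * f = x -> x * s x = 0) ->
  forall x, e * x = x -> x * f = x -> x = 0.
Proof.
have [_ ee se _] := prim_e => ff sf iso x ex xf.
have [z0 xzx] := regular x; pose y := s (f * z0 * e).
have ey : e * y = y by rewrite /y !starM !mulrA se ee.
have yf : y * f = y by rewrite /y !starM -!mulrA sf ff.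
pose g := x * s y; have gx : g * x = x.
  by rewrite /g /y starK !mulrA xf -!mulrA ex mulrA.
have gg : g * g = g by rewrite /g mulrA gx.
have sg : s g = - g.
  have : (x + y) * s (x + y) = 0 by apply: iso; rewrite ?mulrDr ?ex ?ey ?mulrDl ?xf ?yf.
  rewrite starD mulrDl !mulrDr !iso // add0r addr0 => /eqP.
  by rewrite addrC addr_eq0 /g starM starK => /eqP.
have g2 : g + g = 0.
  by apply/eqP; rewrite addr_eq0 -sg -{2}gg starM sg mulrNN gg.
by rewrite -gx -(half g) -mulrnDl g2 mul0rn mul0r.
Qed.

End RegularRing.

(** * Idempotents, one-sided ideals and *-ideals of a finite ring *)

Section FiniteRing.
Variable R : finPzRingType.
Implicit Types (x y e f g : R) (L I : {set R}).

(** By the pigeonhole principle two powers coincide, so the powers of [x] are eventually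
    periodic. *)
Lemma idempotent_expr x : exists2 n, (0 < n)%N & x ^+ n * x ^+ n = x ^+ n.
Proof.
have /injectivePn[i [j neq_ij eq_ij]] :
    ~~ injectiveb (fun i : 'I_#|R|.+1 => x ^+ i).
  apply/injectiveP => /leq_card; rewrite card_ord ltnn //.
wlog lt_ij : i j neq_ij eq_ij / (i < j)%N => [IH|].
  case: (ltngtP i j) => [|lt_ji|/val_inj/eqP]; [exact: IH| |].
    by apply: (IH j i) => //; rewrite eq_sym.
  by rewrite (negPf neq_ij).
pose d := (j - i)%N.
have per m k : (i <= m)%N -> x ^+ (m + k * d) = x ^+ m.
  move=> le_im; have per1 : x ^+ m * x ^+ d = x ^+ m.
    by rewrite -(subnK le_im) -exprD -addnA !exprD -exprD subnKC 1?ltnW ?eq_ij.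
  by elim: k => [|k IHk]; rewrite ?addn0 // mulSn !exprD mulrA per1 -exprD.
(* A multiple of the period [d] that is at least the preperiod [i], so that doubling it does not
   change the power; [i.+1] in place of [i] keeps it positive when [i = 0]. *)
exists (i.+1 * d)%N; first by rewrite muln_gt0 subn_gt0.
rewrite -exprD per // mulSn (leq_trans _ (leq_addl _ _)) //.
by rewrite leq_pmulr // subn_gt0.
Qed.

Definition left_ideal L :=
  [&& 0 \in L, [forall x in L, forall y in L, x - y \in L]
    & [forall a, forall x in L, a * x \in L]].

Lemma left_idealP L :
  reflect [/\ 0 \in L, forall x y, x \in L -> y \in L -> x - y \in L
            & forall a x, x \in L -> a * x \in L]
          (left_ideal L).
Proof.
apply: (iffP and3P) => [[L0 LB LM]|[L0 LB LM]]; split=> //.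
- by move=> x y Lx Ly; apply: (forall_inP (forall_inP LB x Lx)).
- by move=> a x Lx; apply: (forall_inP (forallP LM a)).
- by apply/forall_inP=> x Lx; apply/forall_inP=> y; apply: LB.
- by apply/forallP=> a; apply/forall_inP=> x; apply: LM.
Qed.

Variable s : involution R.

Definition star_ideal I :=
  [&& left_ideal I, [forall a, forall x in I, x * a \in I]
    & [forall x in I, s x \in I]].

Lemma star_idealP I :
  reflect [/\ 0 \in I, forall x y, x \in I -> y \in I -> x - y \in I,
              forall a x, x \in I -> a * x \in I,
              forall a x, x \in I -> x * a \in I
            & forall x, x \in I -> s x \in I]
          (star_ideal I).
Proof.
apply: (iffP and3P) => [[/left_idealP[I0 IB IM] IMr IS]|[I0 IB IM IMr IS]].
  split=> // [a x|x]; last exact: (forall_inP IS).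
  exact: (forall_inP (forallP IMr a)).
split; first exact/left_idealP.
  by apply/forallP=> a; apply/forall_inP=> x; apply: IMr.
exact/forall_inP.
Qed.

Definition max_star_ideal I :=
  [&& star_ideal I, 1 \notin I &
    [forall J : {set R},
       [&& star_ideal J, 1 \notin J & I \subset J] ==> (J == I)]].

(** Annihilation is imposed on both sides and across every middle factor [a]. This makes the
    relation between [y] and [c] symmetric, and gives a *-ideal as soon as [C] is stable under the
    involution. *)
Definition annihilator (C : {set R}) :=
  [set y | [forall c in C, forall a, (y * a * c == 0) && (c * a * y == 0)]].

Lemma annihilatorP (C : {set R}) y :
  reflect (forall c a, c \in C -> y * a * c = 0 /\ c * a * y = 0)
          (y \in annihilator C).
Proof.
rewrite inE; apply: (iffP forall_inP) => [Ny c a Cc|Ny c Cc].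
  by have /andP[/eqP ? /eqP ?] := forallP (Ny c Cc) a.
by apply/forallP=> a; have [-> ->] := Ny c a Cc; rewrite eqxx.
Qed.

Lemma star_ideal_annihilator (C : {set R}) :
  (forall c, c \in C -> s c \in C) -> star_ideal (annihilator C).
Proof.
move=> sC; apply/star_idealP; split.
- by apply/annihilatorP=> c a _; rewrite !mul0r mulr0.
- move=> y z /annihilatorP Ny /annihilatorP Nz; apply/annihilatorP=> c a Cc.
  rewrite !mulrBl mulrBr.
  by have [-> ->] := Ny c a Cc; have [-> ->] := Nz c a Cc; rewrite subrr.
- move=> b y /annihilatorP Ny; apply/annihilatorP=> c a Cc.
  have [yac _] := Ny c a Cc; have [_ cay] := Ny c (a * b) Cc.
  by rewrite -!(mulrA b) yac mulr0 !mulrA -(mulrA c).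
- move=> b y /annihilatorP Ny; apply/annihilatorP=> c a Cc.
  have [yac _] := Ny c (b * a) Cc; have [_ cay] := Ny c a Cc.
  by rewrite !mulrA cay mul0r -(mulrA y).
- move=> y /annihilatorP Ny; apply/annihilatorP=> c a Cc.
  have [y1 y2] := Ny _ (s a) (sC c Cc).
  by split; apply: (inv_inj (starK s)); rewrite !starM ?starK star0 mulrA.
Qed.

(* With a single idempotent lying in every nonzero *-ideal, one set of
   hypotheses covers both *-simple rings (e0 = 1) and the quotient by a
   *-ideal maximal among those that avoid a given idempotent. *)
Section Semiprime.
Variable e0 : R.
Hypotheses (e0_neq0 : e0 <> 0) (e0_idem : e0 * e0 = e0).
Hypothesis e0_min : forall I x, star_ideal I -> x \in I -> x <> 0 -> e0 \in I.

(** Let [N] annihilate [x] and [s x]. If [e0] is in [N], then a nonzero [x] lies in the *-ideal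
    annihilating [e0] and [s e0], which by minimality contains [e0], so [e0 * e0 = 0]. Otherwise
    [N = 0]; but all [s x * a * x] and [x * a * s x] lie in [N], hence vanish, and then [x] itself
    lies in [N]. *)
Lemma semiprime x : (forall a, x * a * x = 0) -> x = 0.
Proof.
move=> xRx; apply/eqP; apply/contraT=> /eqP x_neq0.
have sxRsx a : s x * a * s x = 0.
  by rewrite -[a](starK s) -!starM mulrA xRx star0.
have id2 y : star_ideal (annihilator [set y; s y]).
  apply: star_ideal_annihilator => c /set2P[]->; rewrite ?starK.
    exact: set22.
  exact: set21.
have [e0N|e0N] := boolP (e0 \in annihilator [set x; s x]).
  have /(e0_min (id2 e0))/(_ x_neq0)/annihilatorP/(_ e0 1 (set21 _ _))[] :
      x \in annihilator [set e0; s e0].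
    apply/annihilatorP=> c a; have e0a := annihilatorP _ _ e0N.
    case/set2P=> ->; first by have [] := e0a x a (set21 _ _).
    have [e0x xe0] := e0a (s x) (s a) (set22 _ _).
    by split; apply: (inv_inj (starK s)); rewrite !starM ?starK star0 mulrA.
  by rewrite mulr1 e0_idem.
have N0 y : y \in annihilator [set x; s x] -> y = 0.
  by move=> Ny; apply/eqP; apply: contraNT e0N => /eqP; apply: e0_min Ny.
have sxRx a : s x * a * x = 0.
  apply: N0; apply/annihilatorP=> c b /set2P[]->; split.
  - by rewrite -!(mulrA (s x * a)) mulrA -mulrA xRx mulr0.
  - by have := xRx (b * s x * a); rewrite !mulrA.
  - by have := sxRsx (a * x * b); rewrite !mulrA.
  - by rewrite !mulrA sxRsx !mul0r.
have xRsx a : x * a * s x = 0.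
  apply: N0; apply/annihilatorP=> c b /set2P[]->; split.
  - by have := xRx (a * s x * b); rewrite !mulrA.
  - by rewrite !mulrA xRx !mul0r.
  - by rewrite -!(mulrA (x * a)) mulrA -mulrA sxRsx mulr0.
  - by have := sxRsx (b * x * a); rewrite !mulrA.
by case: x_neq0; apply: N0; apply/annihilatorP=> c a /set2P[]->.
Qed.

Lemma left_ideal_fixed f : left_ideal [set y | y * f == 0].
Proof.
apply/left_idealP; split=> [|x y|a x]; rewrite !inE ?mul0r //.
  by move=> /eqP xf /eqP yf; rewrite mulrBl xf yf subrr.
by move=> /eqP xf; rewrite -mulrA xf mulr0.
Qed.

Lemma left_idealI L1 L2 :
  left_ideal L1 -> left_ideal L2 -> left_ideal (L1 :&: L2).
Proof.
move=> /left_idealP[L10 L1B L1M] /left_idealP[L20 L2B L2M].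
apply/left_idealP; split=> [|x y|a x]; rewrite !inE ?L10 //.
  by case/andP=> x1 x2 /andP[y1 y2]; rewrite L1B ?L2B.
by case/andP=> x1 x2; rewrite L1M ?L2M.
Qed.

(* Brauer's lemma *)
Lemma left_ideal_idempotent L x :
  left_ideal L -> x \in L -> x <> 0 -> exists g, [/\ g \in L, g * g = g & g <> 0].
Proof.
move=> idL Lx x_neq0.
pose good (L' : {set R}) := [&& left_ideal L', L' \subset L & L' != [set 0]].
have goodL : good L.
  rewrite /good idL subxx; apply: contra_notN x_neq0 => /eqP L0.
  by move: Lx; rewrite L0 => /set1P.
have [M /minsetP[/and3P[idM sML M_neq0] minM] _] := minset_exists goodL.
have [M0 MB MM] := left_idealP _ idM.
have M_trivial N : left_ideal N -> N \subset M -> (exists2 z, z \in M & z \notin N) ->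
    forall y, y \in N -> y = 0.
  move=> idN sNM [z Mz notNz] y Ny; apply/eqP/contraT => y_neq0.
  suff eNM : N = M by rewrite eNM Mz in notNz.
  apply: minM => //; rewrite /good idN (subset_trans sNM) //=.
  by apply: contraNneq y_neq0 => N0; rewrite N0 in Ny; apply/eqP/set1P.
have [y My y_neq0] : exists2 y, y \in M & y != 0.
  apply/exists_inP; apply: contraR M_neq0; rewrite negb_exists_in.
  move/forall_inP=> M_0; apply/eqP/setP=> y; rewrite inE.
  apply/idP/eqP => [/M_0|->//]; rewrite negbK; exact/eqP.
have [b yby] : exists b, y * b * y != 0.
  apply/existsP; apply: contraR y_neq0; rewrite negb_exists => /forallP yRy.
  by apply/eqP/semiprime => b; apply/eqP; rewrite -[_ == _]negbK.
pose a := b * y; have Ma : a \in M by apply: MM.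
have idMa : left_ideal [set z * a | z in M].
  apply/left_idealP; split.
  - by apply/imsetP; exists 0; rewrite ?mul0r.
  - move=> _ _ /imsetP[z Mz ->] /imsetP[t Mt ->].
    by apply/imsetP; exists (z - t); rewrite ?mulrBl ?MB.
  - move=> c _ /imsetP[z Mz ->]; apply/imsetP; exists (c * z); rewrite ?mulrA //.
    exact: MM.
have eqMa : [set z * a | z in M] = M.
  have sMaM : [set z * a | z in M] \subset M.
    by apply/subsetP=> _ /imsetP[z Mz ->]; apply: MM.
  apply: minM => //; rewrite /good idMa (subset_trans sMaM) //=.
  apply: contraNneq yby => Ma0; rewrite -mulrA; apply/eqP/set1P.
  by rewrite -Ma0; apply: imset_f.
(* From [M * a = M] comes [g] in [M] with [a = g * a]. The element [g * g - g] then kills [a]; the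
   elements of [M] killing [a] form a left ideal missing [y], which is zero by minimality of [M]. *)
have /imsetP[g Mg def_a] : a \in [set z * a | z in M] by rewrite eqMa.
have a_neq0 : a <> 0 by move=> a0; rewrite -mulrA -/a a0 mulr0 eqxx in yby.
exists g; split; first exact: (subsetP sML).
  apply/eqP; rewrite -subr_eq0; apply/eqP.
  apply: (M_trivial ([set z | z * a == 0] :&: M)); rewrite ?subsetIr //.
  - by apply: left_idealI => //; apply: left_ideal_fixed.
  - exists y => //; rewrite !inE negb_and; apply/orP; left.
    by rewrite mulrA.
  - rewrite !inE mulrBl -mulrA -!def_a subrr eqxx MB //; exact: MM.
by move=> g0; apply: a_neq0; rewrite def_a g0 mul0r.
Qed.

(** Among the idempotents of [L], take [f] with the most elements fixed by right multiplication. An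
    [x] in [L] with [x * f <> x] would allow [f] to be enlarged. *)
Lemma left_ideal_principal L :
  left_ideal L -> exists f, [/\ f \in L, f * f = f & forall x, x \in L -> x * f = x].
Proof.
move=> idL; have [L0 LB LM] := left_idealP _ idL.
pose fix_ f := [set y | y * f == y].
pose good f := (f \in L) && (f * f == f).
have good0 : good 0 by rewrite /good L0 mulr0 eqxx.
case: (arg_maxnP (fun f => #|fix_ f|) good0) => f /andP[Lf /eqP ff] maxf.
exists f; split=> // x Lx; apply/eqP/contraT => xf.
have idLf : left_ideal (L :&: [set y | y * f == 0]).
  by apply: left_idealI => //; apply: left_ideal_fixed.
have [||g [/setIP[Lg]]] := @left_ideal_idempotent _ (x - x * f) idLf.
- by rewrite !inE LB ?mulrBl -?mulrA ?ff ?subrr ?eqxx // LM.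
- by apply/eqP; rewrite subr_eq0 eq_sym.
rewrite inE => /eqP gf gg g_neq0.
(* With [g * f = 0], this idempotent fixes everything that [f] fixes, and also [g], which [f]
   kills. *)
pose f' := f + g - f * g.
have ff' : f * f' = f by rewrite mulrBr mulrDr mulrA ff addrK.
have f'f : f' * f = f by rewrite mulrBl mulrDl -mulrA gf ff mulr0 subr0 addr0.
have f'g : f' * g = g by rewrite mulrBl mulrDl -mulrA gg addrAC subrr add0r.
have f'f' : f' * f' = f'.
  by rewrite [LHS]mulrBr mulrDr mulrA f'f f'g.
have gf' : g * f' = g by rewrite mulrBr mulrDr mulrA gf gg mul0r subr0 add0r.
have/maxf: good f'.
  rewrite /good f'f' eqxx andbT LB ?LM // -[g]opprK -[- g]add0r LB // LB //.
rewrite /= leqNgt => /negP[]; apply/proper_card/properP; split.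
  apply/subsetP=> y; rewrite !inE => /eqP yf.
  by rewrite -[in y * f']yf -mulrA ff' yf.
by exists g; rewrite !inE ?gf' // gf eq_sym; apply/eqP.
Qed.

(** The left ideal generated by [x] has a right identity, which is of the form [y * x]. *)
Lemma von_neumann_regular x : exists y, x * y * x = x.
Proof.
have idRx : left_ideal [set a * x | a in R].
  apply/left_idealP; split=> [|_ _ /imsetP[a _ ->] /imsetP[b _ ->]|b _ /imsetP[a _ ->]].
  - by apply/imsetP; exists 0; rewrite ?mul0r.
  - by apply/imsetP; exists (a - b); rewrite ?mulrBl.
  - by apply/imsetP; exists (b * a); rewrite ?mulrA.
have [f [/imsetP[y _ ->] _ fP]] := left_ideal_principal idRx.
exists y; rewrite -mulrA fP //; apply/imsetP; exists 1 => //.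
by rewrite mul1r.
Qed.

(** The right identity [f] of [I] is carried by the involution to a left identity, so [f] is
    symmetric and central. If [1 - f] were nonzero, the *-ideal of all [y] with [y * f = 0] would
    contain [e0], although [e0] lies in [I] and so [e0 * f = e0]. *)
Lemma star_ideal_unit I x :
  star_ideal I -> x \in I -> x <> 0 -> 1 \in I.
Proof.
move=> idI Ix x_neq0; have [I0 IB IM IMr IS] := star_idealP _ idI.
have [f [If ff fr]] := left_ideal_principal (proj1 (andP idI)).
have sf_l y : y \in I -> s f * y = y.
  by move=> Iy; apply: (inv_inj (starK s)); rewrite starM starK fr ?IS.
have sf : s f = f by rewrite -(fr (s f)) ?IS // sf_l.
have f_l y : y \in I -> f * y = y by move/sf_l; rewrite sf.
have fC b : f * b = b * f by rewrite -(fr (f * b)) ?IMr // -mulrA f_l ?IM.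
have idN : star_ideal [set y | y * f == 0].
  have /left_idealP[N0 NB NM] := left_ideal_fixed f.
  apply/star_idealP; split=> // [a y|y]; rewrite !inE => /eqP yf.
    by rewrite -mulrA -fC mulrA yf mul0r.
  by rewrite -sf -starM fC yf star0.
have e0f : e0 * f = e0 by apply: fr; apply: e0_min Ix x_neq0.
suff: 1 - f = 0 by move/eqP; rewrite subr_eq0 => /eqP->.
apply/eqP/contraT=> /eqP neq; suff: e0 \in [set y | y * f == 0].
  by rewrite inE e0f => /eqP.
by apply: (e0_min idN) neq; rewrite inE mulrBl mul1r ff subrr.
Qed.

End Semiprime.
End FiniteRing.

(** * The quotient of a finite ring with involution by a *-ideal *)

Section StarQuotient.
Variables (R : finPzRingType) (s : involution R) (I : {set R}).

(** A canonical element of the coset of [x]: [pick] depends only on the extension of its predicate,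
    so congruent elements get the same value. The quotient is the finite subtype of these canonical
    elements. *)
Definition coset_canon x := odflt x [pick y | y - x \in I].

Definition star_quot of star_ideal s I := {x : R | coset_canon x == x}.

Hypothesis idI : star_ideal s I.
Local Notation S := (star_quot idI).

HB.instance Definition _ := SubFinite.copy S {x : R | coset_canon x == x}.

Let I0 : 0 \in I. Proof. by have [] := star_idealP _ _ idI. Qed.
Let IB x y : x \in I -> y \in I -> x - y \in I.
Proof. by have [_ IB _ _ _] := star_idealP _ _ idI; apply: IB. Qed.
Let IN x : x \in I -> - x \in I. Proof. by rewrite -sub0r; apply: IB. Qed.
Let ID x y : x \in I -> y \in I -> x + y \in I.
Proof. by move=> Ix Iy; rewrite -[y]opprK IB ?IN. Qed.

Let canon_sub x : coset_canon x - x \in I.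
Proof. by rewrite /coset_canon; case: pickP => //= _; rewrite subrr I0. Qed.

Let canon_eq x y : x - y \in I -> coset_canon x = coset_canon y.
Proof.
move=> Ixy; rewrite /coset_canon.
have eqI z : (z - x \in I) = (z - y \in I).
  apply/idP/idP => Iz; first by rewrite -(subrK x z) -addrA ID.
  by rewrite -(subrK y z) -addrA ID // -opprB IN.
rewrite (eq_pick eqI); case: pickP => // /(_ y).
by rewrite subrr I0.
Qed.

Fact canon_idem x : coset_canon (coset_canon x) == coset_canon x.
Proof. by apply/eqP/canon_eq/canon_sub. Qed.

Definition star_pi x : S := exist _ (coset_canon x) (canon_idem x).

Lemma star_piK (u : S) : star_pi (val u) = u.
Proof. by apply: val_inj => /=; apply/eqP/(valP u). Qed.

Lemma eq_star_pi x y : (star_pi x == star_pi y) = (x - y \in I).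
Proof.
rewrite -val_eqE /=; apply/eqP/idP => [eq_xy|]; last exact: canon_eq.
rewrite -(subrK (coset_canon x) x) -addrA ID //; last by rewrite eq_xy.
by rewrite -opprB IN.
Qed.

Let piE x y : x - y \in I -> star_pi x = star_pi y.
Proof. by rewrite -eq_star_pi => /eqP. Qed.

Let val_pi x : val (star_pi x) - x \in I. Proof. exact: canon_sub. Qed.

Let pi0 := star_pi 0.
Let pi1 := star_pi 1.
Let piN (u : S) := star_pi (- val u).
Let piD (u v : S) := star_pi (val u + val v).
Let piM (u v : S) := star_pi (val u * val v).

Let piNE x : piN (star_pi x) = star_pi (- x).
Proof. by apply: piE; rewrite -opprD IN. Qed.

Let piDE x y : piD (star_pi x) (star_pi y) = star_pi (x + y).
Proof. by apply: piE; rewrite opprD addrACA ID. Qed.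

Let piME x y : piM (star_pi x) (star_pi y) = star_pi (x * y).
Proof.
have [_ _ IM IMr _] := star_idealP _ _ idI.
apply: piE; set u := val _; set v := val _.
rewrite -(subrK (x * v) (u * v)) -addrA -mulrBl -mulrBr.
by apply: ID; [apply: IMr|apply: IM]; apply: val_pi.
Qed.

Let piDA : associative piD.
Proof.
move=> u v w; rewrite -(star_piK u) -(star_piK v) -(star_piK w).
by rewrite !piDE addrA.
Qed.
Let piDC : commutative piD.
Proof. by move=> u v; rewrite /piD addrC. Qed.
Let pi0D : left_id pi0 piD.
Proof. by move=> u; rewrite -(star_piK u) piDE add0r. Qed.
Let piND : left_inverse pi0 piN piD.
Proof. by move=> u; rewrite -(star_piK u) piNE piDE addNr. Qed.

HB.instance Definition _ := GRing.isZmodule.Build S piDA piDC pi0D piND.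

Let piMA : associative piM.
Proof.
move=> u v w; rewrite -(star_piK u) -(star_piK v) -(star_piK w).
by rewrite !piME mulrA.
Qed.
Let pi1M : left_id pi1 piM.
Proof. by move=> u; rewrite -(star_piK u) piME mul1r. Qed.
Let piM1 : right_id pi1 piM.
Proof. by move=> u; rewrite -(star_piK u) piME mulr1. Qed.
Let piMDl : left_distributive piM +%R.
Proof.
move=> u v w; rewrite -(star_piK u) -(star_piK v) -(star_piK w).
by rewrite ![_ + _]piDE !piME [RHS]piDE mulrDl.
Qed.
Let piMDr : right_distributive piM +%R.
Proof.
move=> u v w; rewrite -(star_piK u) -(star_piK v) -(star_piK w).
by rewrite ![_ + _]piDE !piME [RHS]piDE mulrDr.
Qed.

HB.instance Definition _ :=
  GRing.Zmodule_isPzRing.Build S piMA pi1M piM1 piMDl piMDr.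

Fact star_pi_zmod : zmod_morphism star_pi.
Proof. by move=> x y; rewrite -[star_pi (x - y)]piDE -piNE. Qed.

Fact star_pi_monoid : monoid_morphism star_pi.
Proof. by split=> // x y; rewrite -piME. Qed.

HB.instance Definition _ := GRing.isZmodMorphism.Build R S star_pi star_pi_zmod.
HB.instance Definition _ :=
  GRing.isMonoidMorphism.Build R S star_pi star_pi_monoid.

Lemma star_pi_eq0 x : (star_pi x == 0) = (x \in I).
Proof. by rewrite -[0](rmorph0 star_pi) eq_star_pi subr0. Qed.

Let qstar (u : S) : S := star_pi (s (val u)).

Let qstarE x : qstar (star_pi x) = star_pi (s x).
Proof.
have [_ _ _ _ IS] := star_idealP _ _ idI.
by apply: piE; rewrite -starB IS.
Qed.

Fact qstarD : {morph qstar : u v / u + v}.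
Proof.
move=> u v; rewrite -(star_piK u) -(star_piK v) -rmorphD !qstarE.
by rewrite starD rmorphD.
Qed.

Fact qstarM u v : qstar (u * v) = qstar v * qstar u.
Proof.
rewrite -(star_piK u) -(star_piK v) -rmorphM !qstarE.
by rewrite starM rmorphM.
Qed.

Fact qstarK : involutive qstar.
Proof. by move=> u; rewrite -(star_piK u) !qstarE starK. Qed.

Definition quot_star : involution S := Involution qstarD qstarM qstarK.

Lemma quot_starE x : quot_star (star_pi x) = star_pi (s x).
Proof. exact: qstarE. Qed.

Lemma star_ideal_preim (J : {set S}) :
  star_ideal quot_star J -> star_ideal s [set x | star_pi x \in J].
Proof.
case/star_idealP=> J0 JB JM JMr JS; apply/star_idealP.
split=> [|x y|a x|a x|x]; rewrite !inE ?rmorph0 ?rmorphB ?rmorphM //.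
- exact: JB.
- exact: JM.
- exact: JMr.
- by move/JS; rewrite quot_starE.
Qed.

Lemma sub_star_ideal_preim (J : {set S}) :
  star_ideal quot_star J -> I \subset [set x | star_pi x \in J].
Proof.
case/star_idealP=> J0 _ _ _ _; apply/subsetP=> x; rewrite inE -star_pi_eq0.
by move/eqP->.
Qed.

(** An ideal containing [I] is a union of cosets of [I], so membership can be read off the canonical
    representative. *)
Lemma mem_star_pi (J : {set R}) x :
  star_ideal s J -> I \subset J ->
  (star_pi x \in [set u : S | val u \in J]) = (x \in J).
Proof.
case/star_idealP=> J0 JB _ _ _ /subsetP sIJ; rewrite inE.
have JN y : y \in J -> - y \in J by rewrite -sub0r; apply: JB.
have := sIJ _ (val_pi x); set y := val _ => Jyx.
apply/idP/idP => [Jy|Jx]; last by rewrite -(subrK x y) -[x in _ + x]opprK JB ?JN.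
by rewrite -(subKr y x) JB.
Qed.

Lemma star_ideal_im (J : {set R}) :
  star_ideal s J -> I \subset J ->
  star_ideal quot_star [set u : S | val u \in J].
Proof.
move=> idJ sIJ; have [J0 JB JM JMr JS] := star_idealP _ _ idJ.
have memJ x := mem_star_pi x idJ sIJ.
apply/star_idealP; split=> [|u v|u v|u v|u].
- by rewrite -(rmorph0 star_pi) memJ.
- rewrite -(star_piK u) -(star_piK v) -rmorphB !memJ; exact: JB.
- rewrite -(star_piK u) -(star_piK v) -rmorphM !memJ; exact: JM.
- rewrite -(star_piK u) -(star_piK v) -rmorphM !memJ; exact: JMr.
- rewrite -(star_piK u) quot_starE !memJ; exact: JS.
Qed.

End StarQuotient.

(** * Each primitive symmetric idempotent avoids exactly one maximal *-ideal *)

Section MaxStarIdeals.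
Variables (R : finPzRingType) (s : involution R).
Implicit Types I J : {set R}.

Lemma max_star_idealP I :
  reflect [/\ star_ideal s I, 1 \notin I &
             forall J, star_ideal s J -> 1 \notin J -> I \subset J -> J = I]
          (max_star_ideal s I).
Proof.
apply: (iffP and3P) => [[idI I1 maxI]|[idI I1 maxI]]; split=> //.
  move=> J idJ J1 sIJ; apply/eqP/(implyP (forallP maxI J)).
  by rewrite idJ J1.
by apply/forallP=> J; apply/implyP=> /and3P[idJ J1 sIJ]; apply/eqP/maxI.
Qed.

(** Modulo a *-ideal maximal among those avoiding [e], the image of [e] can serve as the [e0] of
    [star_ideal_unit]; so any strictly larger *-ideal contains 1. *)
Lemma exists_max_star_ideal e :
  e <> 0 -> e * e = e -> exists2 I, max_star_ideal s I & e \notin I.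
Proof.
move=> e_neq0 ee; pose good I := star_ideal s I && (e \notin I).
have good0 : good [set 0].
  apply/andP; split; last by apply/set1P.
  apply/star_idealP; split=> [|x y|a x|a x|x]; rewrite !inE //.
  - by move=> /eqP-> /eqP->; rewrite subrr.
  - by move=> /eqP->; rewrite mulr0.
  - by move=> /eqP->; rewrite mul0r.
  - by move=> /eqP->; rewrite star0.
have [I /maxsetP[/andP[idI notIe] maxI] _] := maxset_exists good0.
exists I => //; pose pi := star_pi idI; have [I0 _ IM _ _] := star_idealP _ _ idI.
have e0_min (J : {set star_quot idI}) x :
  star_ideal (quot_star idI) J -> x \in J -> x <> 0 -> pi e \in J.
  move=> idJ Jx /eqP; rewrite -(star_piK x) star_pi_eq0; apply: contraR => notJe.
  suff: val x \in [set y | star_pi idI y \in J].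
    rewrite (maxI _ _ (sub_star_ideal_preim idJ)) //.
    by rewrite /good star_ideal_preim // inE.
  by rewrite inE star_piK.
apply/max_star_idealP; split=> //.
  by apply: contra notIe => I1; rewrite -[e]mulr1 IM.
move=> J idJ J1 sIJ; apply/eqP; rewrite eqEsubset sIJ andbT.
apply/subsetP=> x Jx; apply: contraR J1 => notIx.
rewrite -(mem_star_pi idI 1 idJ sIJ) rmorph1.
apply: (@star_ideal_unit _ _ (pi e) _ _ e0_min _ (pi x)).
- by move/eqP; rewrite star_pi_eq0 (negPf notIe).
- by rewrite -rmorphM ee.
- exact: star_ideal_im.
- by rewrite mem_star_pi.
- by move/eqP; rewrite star_pi_eq0 (negPf notIx).
Qed.

Lemma max_star_ideal_unique e I J :
    star_primitive s e -> max_star_ideal s I -> max_star_ideal s J ->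
  e \notin I -> e \notin J -> I = J.
Proof.
case=> e_neq0 ee se e_prim.
case/max_star_idealP=> idI I1 maxI /max_star_idealP[idJ J1 maxJ] Ie Je.
have [I0 IB IM IMr IS] := star_idealP _ _ idI.
have [J0 JB JM JMr JS] := star_idealP _ _ idJ.
have JD x y : x \in J -> y \in J -> x + y \in J.
  by move=> Jx Jy; rewrite -[y]opprK JB // -sub0r JB.
pose IJ := [set x | [exists y in I, x - y \in J]].
have IJP x : reflect (exists2 y, y \in I & x - y \in J) (x \in IJ).
  by rewrite inE; apply: exists_inP.
have idIJ : star_ideal s IJ.
  apply/star_idealP; split.
  - by apply/IJP; exists 0; rewrite ?subrr.
  - move=> x y /IJP[x1 Ix1 Jx] /IJP[y1 Iy1 Jy]; apply/IJP.
    exists (x1 - y1); rewrite ?IB //.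
    by rewrite opprD addrACA -opprD JB.
  - move=> a x /IJP[x1 Ix1 Jx]; apply/IJP; exists (a * x1); rewrite ?IM //.
    by rewrite -mulrBr JM.
  - move=> a x /IJP[x1 Ix1 Jx]; apply/IJP; exists (x1 * a); rewrite ?IMr //.
    by rewrite -mulrBl JMr.
  - move=> x /IJP[x1 Ix1 Jx]; apply/IJP; exists (s x1); rewrite ?IS //.
    by rewrite -starB JS.
(* If the sum of the two ideals is proper, maximality makes it equal to both. Otherwise [i] is in
   [I] and [1 - i] in [J]. *)
have [/IJP[i Ii Ji]|IJ1] := boolP (1 \in IJ); last first.
  transitivity IJ; [apply/esym/maxI=> // | apply: maxJ => //].
    by apply/subsetP=> x Ix; apply/IJP; exists x; rewrite ?subrr.
  by apply/subsetP=> x Jx; apply/IJP; exists 0; rewrite ?subr0.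
(* Both [x] and [z] lie in [I] and are congruent to [e] modulo [J], as are all positive powers of
   [z]. An idempotent power of the symmetric [z] is [0] or [e]: the former puts [e] in [J], the
   latter puts [e] in [I]. *)
pose x := e * i * e; pose z := x * s x.
have Iz : z \in I by rewrite IMr // IMr // IM.
have Jex : e - x \in J.
  by rewrite -{1}ee -{1}[e]mulr1 -mulrBl -mulrBr JMr // JM.
have ex : e * x = x by rewrite !mulrA ee.
have xe : x * e = x by rewrite -mulrA ee.
have esx : e * s x = s x by rewrite -{1}se -starM xe.
have Jez : e - z \in J.
  have -> : e - z = (e - x) * s x + s (e - x).
    by rewrite starB se mulrBl esx [RHS]addrC addrA subrK.
  by rewrite JD ?JS ?JMr.
have ez : e * z = z by rewrite mulrA ex.
have ze : z * e = z by rewrite -mulrA -[in LHS]se -starM ex.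
have zXe m : z ^+ m.+1 * e = z ^+ m.+1 by rewrite exprSr -mulrA ze.
have Jezn m : e - z ^+ m.+1 \in J.
  elim: m => [|m IHm]; first by rewrite expr1.
  rewrite -(subrK (z ^+ m.+1) e) -addrA JD //.
  by rewrite -{1}zXe (exprSr z m.+1) -mulrBr JM.
have [[//|n] _ idemz] := idempotent_expr z.
have [||||g0|ge] := e_prim (z ^+ n.+1) => //.
- by rewrite starX starM starK.
- by rewrite exprS mulrA ez.
- by have := Jezn n; rewrite g0 subr0 (negPf Je).
- by move: Ie; rewrite -ge exprSr IM.
Qed.

End MaxStarIdeals.

(** * Counting decompositions of 1 into primitive symmetric idempotents *)

Section PrimitiveFrames.
Variables (R : finPzRingType) (s : involution R) (k : nat).
Hypothesis two_k : k.*2%:R = 1 :> R.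

Section Simple.
Variables (I : {set R}) (idI : star_ideal s I).
Hypothesis max_I : max_star_ideal s I.
Local Notation pi := (star_pi idI).
Local Notation S := (star_quot idI).
Local Notation qs := (quot_star idI).

Let two_kS : k.*2%:R = 1 :> S.
Proof. by rewrite -(rmorph_nat pi) two_k rmorph1. Qed.

(** The minimality hypothesis [e0_min] for the quotient, with [e0 = 1]. *)
Lemma quot_star_simple (J : {set S}) u :
  star_ideal qs J -> u \in J -> u <> 0 -> 1 \in J.
Proof.
case/max_star_idealP: max_I => _ I1 maxI idJ Ju /eqP.
rewrite -(star_piK u) star_pi_eq0; apply: contraR => notJ1.
suff: val u \in [set y | pi y \in J].
  rewrite (maxI _ (star_ideal_preim idJ)) ?inE ?rmorph1 //.
  exact: sub_star_ideal_preim.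
by rewrite inE star_piK.
Qed.

Let one_neq0 : (1 : S) <> 0.
Proof.
case/max_star_idealP: max_I => _ I1 _.
by rewrite -(rmorph1 pi) => /eqP; rewrite star_pi_eq0 (negPf I1).
Qed.

Lemma quot_regular (u : S) : exists v, u * v * u = u.
Proof. exact: (von_neumann_regular one_neq0 (mulr1 1) quot_star_simple). Qed.

(** A symmetric idempotent [g] below the image of [e] lifts to a symmetric [r'] in the corner of
    [e], by compressing and averaging with the adjoint. An idempotent power of [r'] is [0] or [e],
    and it still maps to [g] because [g] is idempotent. *)
Lemma quot_primitive e :
  star_primitive s e -> e \notin I -> star_primitive qs (pi e).
Proof.
case=> e_neq0 ee se e_prim notIe; split.
- by move/eqP; rewrite star_pi_eq0 (negPf notIe).
- by rewrite -rmorphM ee.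
- by rewrite quot_starE se.
move=> g gg sg eg ge; pose r := e * val g * e; pose r' := (r + s r) *+ k.
have pir : pi r = g by rewrite !rmorphM /= star_piK eg ge.
have pir' : pi r' = g.
  by rewrite rmorphMn rmorphD /= -quot_starE pir sg mulrnDl -mulrnDr addnn -mulr_natr two_kS mulr1.
have sr' : s r' = r' by rewrite starMn starD starK addrC.
have er' : e * r' = r'.
  by rewrite /r' /r mulrnAr mulrDr !starM se !mulrA ee.
have r'e : r' * e = r' by rewrite -sr' -[in LHS]se -starM er'.
have gX n : g ^+ n.+1 = g by elim: n => // n IHn; rewrite exprS IHn gg.
have [[//|n] _ idem] := idempotent_expr r'.
have [||||r0|re] := e_prim (r' ^+ n.+1) => //.
- by rewrite starX sr'.
- by rewrite exprS mulrA er'.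
- by rewrite exprSr -mulrA r'e.
- by left; rewrite -(gX n) -pir' -rmorphXn r0 rmorph0.
- by right; rewrite -(gX n) -pir' -rmorphXn re.
Qed.

Lemma primitive_equiv e f :
    star_primitive s e -> star_primitive s f -> e \notin I -> f \notin I ->
  exists x y, [/\ x * y = e, y * x = f, e * x = x, x * f = x & f * y = y /\ y * e = y].
Proof.
move=> prim_e prim_f notIe notIf.
have qprim_e := quot_primitive prim_e notIe.
have [e_neq0 ee se _] := prim_e; have [f_neq0 ff sf f_prim] := prim_f.
have [qe_neq0 qee qse _] := qprim_e.
have [qf_neq0 qff qsf _] := quot_primitive prim_f notIf.
(* If no such [u] exists, [isotropic_corner_eq0] kills the whole corner between [e] and [f]. Then
   the image of [f] annihilates that of [e], and *-simplicity puts 1 in the annihilator, so that [e]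
   has image zero. *)
have [u [eu uf usu]] : exists u, [/\ pi e * u = u, u * pi f = u & u * qs u != 0].
  have [/existsP[u /and3P[/eqP ? /eqP ? ?]]|] :=
    boolP [exists u, [&& pi e * u == u, u * pi f == u & u * qs u != 0]]; first by exists u.
  rewrite negb_exists => /forallP iso.
  have corner0 := isotropic_corner_eq0 two_kS quot_regular qprim_e qff qsf.
  suff: pi f \in annihilator [set pi e].
    have idA : star_ideal qs (annihilator [set pi e]).
      by apply: star_ideal_annihilator => c /set1P->; rewrite qse set11.
    move/(quot_star_simple idA)/(_ qf_neq0)/annihilatorP/(_ _ 1 (set11 _))=> [].
    by rewrite !mul1r.
  have efa0 a : pi e * a * pi f = 0.
    apply: corner0 => [x ex xf||]; last by rewrite -[LHS]mulrA qff.
      by apply/eqP; have := iso x; rewrite ex xf !eqxx negbK.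
    by rewrite !mulrA qee.
  apply/annihilatorP=> _ a /set1P->; split=> //.
  by apply: (inv_inj (starK qs)); rewrite !starM qse qsf star0 mulrA.
pose x := e * val u * f.
have pix : pi x = u by rewrite !rmorphM /= star_piK eu uf.
have ex : e * x = x by rewrite !mulrA ee.
have xf : x * f = x by rewrite -mulrA ff.
have fsx : f * s x = s x by rewrite -{1}sf -starM xf.
have sxe : s x * e = s x by rewrite -[in LHS]se -starM ex.
clearbody x; pose z := x * s x; have sz : s z = z by rewrite starM starK.
have ez : e * z = z by rewrite mulrA ex.
have ze : z * e = z by rewrite -mulrA sxe.
have [[//|n] _ idem] := idempotent_expr z.
have [_ _ _ e_prim] := prim_e.
(* The idempotent power of [z] is not zero: otherwise [u * qs u] would be a symmetric nilpotent in
   the corner of [pi e], hence zero. So it equals [e], which makes [s x * z ^+ n] a right inverse of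
   [x] relative to [e]. *)
have [||||z0|zne] := e_prim (z ^+ n.+1) => //.
- by rewrite starX sz.
- by rewrite exprS mulrA ez.
- by rewrite exprSr -mulrA ze.
- case/eqP: usu; have piz : pi z = u * qs u by rewrite rmorphM /= -quot_starE pix.
  rewrite -piz; apply: (symmetric_nilpotent two_kS quot_regular qprim_e (n := n.+1)).
  + by rewrite -rmorphM ez.
  + by rewrite -rmorphM ze.
  + by rewrite quot_starE sz.
  + by rewrite -rmorphXn z0 rmorph0.
pose y := s x * z ^+ n; have xy : x * y = e by rewrite mulrA -exprS.
have fy : f * y = y by rewrite mulrA fsx.
have ye : y * e = y.
  rewrite /y; case: (n) => [|m]; first by rewrite mulr1 sxe.
  by rewrite exprSr -mulrA -(mulrA _ z) ze.
exists x, y; split=> //.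
have yx_f : y * x * f = y * x by rewrite -mulrA xf.
(* From [x * y = e] it follows that [y * x] is idempotent; it is symmetric because [z] is, and it
   lies in the corner of [f]. *)
have [||||yx0|//] := f_prim (y * x) => //.
- by rewrite -mulrA (mulrA x) xy ex.
- by rewrite /y !starM starX sz starK !mulrA.
- by rewrite mulrA fy.
have : x * y * (x * y) = 0 by rewrite mulrA -(mulrA x) yx0 mulr0 mul0r.
by rewrite xy ee.
Qed.

Definition star_frame (T : finType) (D : {set T}) (E : T -> R) : Prop :=
  [/\ forall t, t \in D -> star_primitive s (E t),
      forall t u, t \in D -> u \in D -> t != u -> E t * E u = 0
    & \sum_(t in D) E t = 1].

(** The quotient is the direct sum of the left ideals generated by the images of the [E t] outside
    [I]. Right multiplication by the [x] of [primitive_equiv] identifies each of them with the left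
    ideal of [pi e], the inverse being right multiplication by [y]. *)
Lemma card_quot_frame (T : finType) (D : {set T}) (E : T -> R) e :
    star_frame D E -> star_primitive s e -> e \notin I ->
  #|{: S}| = (#|[set (u * pi e)%R | u : S]| ^ #|[set t in D | E t \notin I]|)%N.
Proof.
move=> [prim_E orthE sumE] prim_e notIe; set DI := [set t in D | _].
have /fin_all_exists[xy xyP] t : exists xy : S * S, t \in DI ->
    [/\ xy.1 * xy.2 = pi (E t), xy.2 * xy.1 = pi e,
        pi (E t) * xy.1 = xy.1, xy.1 * pi e = xy.1 & xy.2 * pi (E t) = xy.2].
  have [/setIdP[Dt notIt]|_] := boolP (t \in DI); last by exists (0, 0).
  have [x [y [xy yx ex xf [fy ye]]]] := primitive_equiv (prim_E t Dt) prim_e notIt notIe.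
  by exists (pi x, pi y) => _ /=; rewrite -!rmorphM xy yx ex xf ye.
have sum_pi : \sum_(t in DI) pi (E t) = 1.
  rewrite -(rmorph1 pi) -sumE rmorph_sum [RHS](bigID (mem DI)) /=.
  rewrite [X in _ = _ + X]big1 ?addr0; last first.
    move=> t /andP[Dt notDIt]; apply/eqP; rewrite star_pi_eq0.
    by apply: contraR notDIt => notIt; rewrite inE Dt.
  by apply: eq_bigl => t; rewrite inE; case: (t \in D).
have orth_pi t u : t \in DI -> u \in DI -> t != u -> pi (E t) * pi (E u) = 0.
  by move=> /setIdP[Dt _] /setIdP[Du _] tu; rewrite -rmorphM orthE ?rmorph0.
pose phi (u : S) := [ffun t => if t \in DI then u * (xy t).1 else 0].
have inj_phi : injective phi.
  move=> u v /ffunP eq_uv; rewrite -[u]mulr1 -[v]mulr1 -sum_pi !mulr_sumr.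
  apply: eq_bigr => t DIt; have := eq_uv t; rewrite !ffunE DIt.
  by have [<- _ _ _ _] := xyP t DIt; rewrite !mulrA => ->.
rewrite -cardsT -(card_imset _ inj_phi) -(card_pffun_on 0).
apply: eq_card => F; apply/imsetP/pffun_onP => [[u _ ->]|[/supportP F0 FD]].
  split; first by apply/supportP=> t /negPf notDt; rewrite ffunE notDt.
  move=> _ /imageP[t DIt ->]; rewrite ffunE DIt; apply/imsetP.
  by exists (u * (xy t).1) => //; rewrite -mulrA; have [_ _ _ -> _] := xyP t DIt.
exists (\sum_(t in DI) F t * (xy t).2) => //; apply/ffunP=> t; rewrite ffunE.
case: ifPn => [DIt|/F0//]; rewrite mulr_suml (bigD1 t) //= big1 => [|u /andP[DIu neq]].
  have [_ yx _ _ _] := xyP t DIt; rewrite -mulrA yx addr0.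
  have /imsetP[v _ ->] : F t \in [set u * pi e | u : S] by apply/FD/image_f.
  by rewrite -mulrA -rmorphM; have [_ -> _ _] := prim_e.
have [_ _ _ _ yE] := xyP u DIu; have [_ _ Ex _ _] := xyP t DIt.
by rewrite -yE -Ex -!mulrA (mulrA (pi _)) orth_pi ?mul0r ?mulr0.
Qed.

(** Since a frame sums to 1, some [E1 t] lies outside [I]. Using it as [e] for both frames writes
    the order of the quotient as two powers of one base, which exceeds 1 because the left ideal
    contains both 0 and the image of [e]. *)
Lemma card_frame_max_ideal (T1 T2 : finType) (D1 : {set T1}) (D2 : {set T2})
    (E1 : T1 -> R) (E2 : T2 -> R) :
    star_frame D1 E1 -> star_frame D2 E2 ->
  #|[set t in D1 | E1 t \notin I]| = #|[set t in D2 | E2 t \notin I]|.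
Proof.
move=> frame1 frame2; have [prim1 _ sum1] := frame1.
have /exists_inP[t Dt notIt] : [exists t in D1, E1 t \notin I].
  case/max_star_idealP: max_I => [] /star_idealP[I0 IB _ _ _] I1 _.
  apply: contraR I1; rewrite negb_exists_in => /forall_inP I_E; rewrite -sum1.
  apply: (big_ind (fun x => x \in I)) => // [x y Ix Iy|u /I_E/negPn//].
  by rewrite -[y]opprK IB // -sub0r IB.
have prim := prim1 t Dt.
apply: (@expnI #|[set u * pi (E1 t) | u : S]|).
  rewrite (cardD1 0) (cardD1 (pi (E1 t))) !inE.
  have [/eqP e_neq0 _ _ _] := quot_primitive prim notIt; rewrite e_neq0.
  have -> : (0 : S) \in [set u * pi (E1 t) | u : S].
    by apply/imsetP; exists 0; rewrite ?mul0r.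
  have -> : pi (E1 t) \in [set u * pi (E1 t) | u : S]; last by [].
  by apply/imsetP; exists 1; rewrite ?mul1r.
by rewrite -!card_quot_frame.
Qed.

End Simple.

(** Each idempotent of a frame is counted at the one maximal *-ideal that it avoids, and these
    counts agree ideal by ideal. *)
Lemma card_frame (T1 T2 : finType) (D1 : {set T1}) (D2 : {set T2})
    (E1 : T1 -> R) (E2 : T2 -> R) :
  star_frame D1 E1 -> star_frame D2 E2 -> #|D1| = #|D2|.
Proof.
move=> frame1 frame2.
have count (T : finType) (D : {set T}) (E : T -> R) : star_frame D E ->
    #|D| = \sum_(I | max_star_ideal s I) #|[set t in D | E t \notin I]|.
  case=> primE _ _; under eq_bigr do rewrite -sum1dep_card.
  rewrite (exchange_big_dep (mem D)) /= => [|I t _ /andP[]//].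
  rewrite -sum1_card; apply: eq_bigr => t Dt.
  have [e_neq0 ee _ _] := primE t Dt.
  have [I maxI notIt] := exists_max_star_ideal s e_neq0 ee.
  rewrite (big_pred1 I) // => J /=; rewrite Dt /=.
  apply/andP/eqP => [[maxJ notJt]|->//].
  exact: max_star_ideal_unique (primE t Dt) maxJ maxI notJt notIt.
rewrite (count _ _ _ frame1) (count _ _ _ frame2); apply: eq_bigr => I maxI.
have [idI _ _] := max_star_idealP _ _ maxI.
exact: (card_frame_max_ideal idI).
Qed.

End PrimitiveFrames.

End StarRings.

(** * The ring of adjoints of the commutator form *)

Section AdjointRing.
Import GRing.Theory.
Local Open Scope group_scope.
Variables (gT : finGroupType) (Q : {group gT}).
Hypothesis derQ : Q^`(1) = 'Z(Q).
Local Notation V := (Vq Q).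
Local Notation B := (@Bi gT Q).
Implicit Types (u v w : cosT Q) (f g : endT Q).

Lemma Vq_abelian : abelian V.
Proof. exact: sub_der1_abelian. Qed.

Let der_norm : Q \subset 'N(Q^`(1)).
Proof. exact: der_norm. Qed.

Lemma Vq_coset u : u \in V -> exists2 x, x \in Q & u = coset Q^`(1) x.
Proof. by case/morphimP=> x _ Qx ->; exists x. Qed.

Let central x y : x \in 'Z(Q) -> y \in Q -> commute x y.
Proof. by case/centerP=> _; apply. Qed.

Let comm_der x y : x \in Q -> y \in Q -> [~ x, y] \in 'Z(Q).
Proof. by move=> Qx Qy; rewrite -derQ mem_commg. Qed.

(** The representatives chosen in [Bi] differ from [x] and [y] by elements of [Q' = Z(Q)], which do
    not affect commutators. *)
Lemma BiE x y : x \in Q -> y \in Q ->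
  B (coset Q^`(1) x) (coset Q^`(1) y) = [~ x, y].
Proof.
have reprE z : z \in Q -> exists2 c, c \in 'Z(Q) & repr (coset Q^`(1) z) = c * z.
  move=> Qz; suff /rcosetP[c Q'c ->] : repr (coset Q^`(1) z) \in Q^`(1) :* z.
    by exists c; rewrite // -derQ.
  by rewrite -val_coset ?mem_repr_coset // (subsetP der_norm).
move=> Qx Qy; rewrite /Bi; have [c Zc ->] := reprE x Qx.
have [d Zd ->] := reprE y Qy.
have Qd : d \in Q by case/centerP: Zd.
have /commgP/eqP cd1 : commute c (d * y) by apply: central; rewrite ?groupM.
have /commgP/eqP xd1 : commute x d by apply/commute_sym/central.
by rewrite commMgJ cd1 conj1g mul1g commgMJ xd1 conj1g mulg1.
Qed.

Lemma BiMl u v w : u \in V -> v \in V -> w \in V -> B (u * v) w = B u w * B v w.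
Proof.
move=> /Vq_coset[x Qx ->] /Vq_coset[y Qy ->] /Vq_coset[z Qz ->].
rewrite -morphM ?(subsetP der_norm) // !BiE ?groupM // commMgJ conjgE.
by rewrite (central (comm_der Qx Qz) Qy) mulKg.
Qed.

Lemma Bi_sym u v : u \in V -> v \in V -> B v u = (B u v)^-1.
Proof. by move=> /Vq_coset[x Qx ->] /Vq_coset[y Qy ->]; rewrite !BiE // invg_comm. Qed.

Lemma Bi_comm u v w t : u \in V -> v \in V -> w \in V -> t \in V ->
  commute (B u v) (B w t).
Proof.
move=> /Vq_coset[x Qx ->] /Vq_coset[y Qy ->] /Vq_coset[z Qz ->] /Vq_coset[r Qr ->].
by rewrite !BiE //; apply: central; rewrite ?comm_der ?groupR.
Qed.

Lemma BiMr u v w : u \in V -> v \in V -> w \in V -> B u (v * w) = B u v * B u w.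
Proof.
move=> Vu Vv Vw; rewrite Bi_sym ?groupM // BiMl // invMg -!Bi_sym //.
exact: Bi_comm.
Qed.

Lemma Bi1l u : u \in V -> B 1 u = 1.
Proof.
move=> Vu; have V1 := group1 (Q / Q^`(1)).
by apply: (mulgI (B 1 u)); rewrite -BiMl ?mul1g ?mulg1.
Qed.

Lemma Bi1r u : u \in V -> B u 1 = 1.
Proof. by move=> Vu; rewrite Bi_sym ?Bi1l ?invg1 // group1. Qed.

Lemma BiVr u v : u \in V -> v \in V -> B u v^-1 = (B u v)^-1.
Proof.
move=> Vu Vv; apply: (mulgI (B u v)).
by rewrite mulgV -BiMr ?groupV // mulgV Bi1r.
Qed.

Lemma BiVl u v : u \in V -> v \in V -> B u^-1 v = (B u v)^-1.
Proof. by move=> Vu Vv; rewrite Bi_sym ?groupV // BiVr // -Bi_sym. Qed.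

Lemma Bi_nondegenerate u : u \in V -> (forall v, v \in V -> B v u = 1) -> u = 1.
Proof.
case/Vq_coset=> x Qx -> Bx; apply: coset_id; rewrite derQ; apply/centerP.
split=> // y Qy; apply/commute_sym/commgP/eqP; rewrite -BiE // Bx //.
exact: mem_quotient.
Qed.

Lemma is_endP f :
  reflect [/\ {in V &, {morph f : u v / u * v}}, forall u, u \in V -> f u \in V
            & forall u, u \notin V -> f u = 1]
          (is_end f).
Proof.
apply: (iffP and3P) => [[fM fV f1]|[fM fV f1]].
  split=> [u v Vu Vv|u|u]; first exact/eqP/(forall_inP (forall_inP fM u Vu)).
    exact: (forall_inP fV).
  by move/(implyP (forallP f1 u))/eqP.
split; last by apply/forallP=> u; apply/implyP=> /f1->.
  by apply/forall_inP=> u Vu; apply/forall_inP=> v Vv; rewrite fM.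
by apply/forall_inP.
Qed.

Lemma is_end_mem f u : is_end f -> f u \in V.
Proof.
case/is_endP=> _ fV f1; have [/fV//|/f1->] := boolP (u \in V).
exact: group1.
Qed.

Lemma is_end1 f : is_end f -> f 1 = 1.
Proof.
case/is_endP=> fM _ _; have V1 := group1 (Q / Q^`(1)).
by apply: (mulgI (f 1)); rewrite -fM ?mulg1.
Qed.

Lemma is_endV f u : is_end f -> u \in V -> f u^-1 = (f u)^-1.
Proof.
move=> endf Vu; have [fM _ _] := is_endP _ endf; apply: (mulgI (f u)).
by rewrite -fM ?groupV // !mulgV is_end1.
Qed.

Lemma eq_end f g : is_end f -> is_end g -> (forall u, u \in V -> f u = g u) -> f = g.
Proof.
move=> /is_endP[_ _ f1] /is_endP[_ _ g1] eq_fg; apply/ffunP=> u.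
by have [/eq_fg//|notVu] := boolP (u \in V); rewrite f1 ?g1.
Qed.

Lemma is_adjointP f g :
  reflect [/\ is_end f, is_end g & forall u v, u \in V -> v \in V -> B (f u) v = B u (g v)]
          (is_adjoint f g).
Proof.
apply: (iffP and3P) => [[endf endg fg]|[endf endg fg]]; split=> //.
  by move=> u v Vu Vv; apply/eqP/(forall_inP (forall_inP fg u Vu)).
by apply/forall_inP=> u Vu; apply/forall_inP=> v Vv; rewrite fg.
Qed.

Lemma is_adjoint_sym f g : is_adjoint f g -> is_adjoint g f.
Proof.
case/is_adjointP=> endf endg fg; apply/is_adjointP; split=> // u v Vu Vv.
by rewrite Bi_sym ?is_end_mem // -fg // -Bi_sym ?is_end_mem.
Qed.

Lemma is_adjoint_inj f g g' : is_adjoint f g -> is_adjoint f g' -> g = g'.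
Proof.
move=> /is_adjointP[_ endg fg] /is_adjointP[_ endg' fg'].
apply: eq_end => // v Vv; apply/eqP; rewrite eq_mulgV1; apply/eqP.
apply: Bi_nondegenerate => [|u Vu]; first by rewrite groupM ?groupV ?is_end_mem.
by rewrite BiMr ?BiVr ?groupV ?is_end_mem // -fg // -fg' // mulgV.
Qed.

(** The identity is cut off outside [V], as [is_end] demands, so that maps agreeing on [V] are equal
    as finite functions. *)
Definition oneE : endT Q := [ffun u => if u \in V then u else 1].

Lemma zero_end : is_end (zeroE Q).
Proof.
apply/is_endP; split=> [u v _ _|u _|u _]; rewrite !ffunE ?mulg1 //.
Qed.

Lemma one_end : is_end oneE.
Proof.
apply/is_endP; split=> [u v Vu Vv|u Vu|u /negPf notVu]; rewrite !ffunE.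
- by rewrite Vu Vv groupM.
- by rewrite Vu.
- by rewrite notVu.
Qed.

Lemma add_end f g : is_end f -> is_end g -> is_end (addE f g).
Proof.
move=> endf endg; have [fM fV f1] := is_endP _ endf; have [gM gV g1] := is_endP _ endg.
apply/is_endP; split=> [u v Vu Vv|u Vu|u notVu]; rewrite !ffunE.
- rewrite fM // gM // -!mulgA; congr (_ * _); rewrite !mulgA; congr (_ * _).
  exact: (centsP Vq_abelian) (fV _ Vv) _ (gV _ Vu).
- by rewrite groupM ?is_end_mem.
- by rewrite f1 // g1 // mulg1.
Qed.

Lemma opp_end f : is_end f -> is_end (oppE f).
Proof.
move=> endf; have [fM fV f1] := is_endP _ endf.
apply/is_endP; split=> [u v Vu Vv|u Vu|u notVu]; rewrite !ffunE.
- by rewrite fM // invMg; apply: (centsP Vq_abelian); rewrite groupV fV.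
- by rewrite groupV is_end_mem.
- by rewrite f1 // invg1.
Qed.

Lemma mul_end f g : is_end f -> is_end g -> is_end (mulE f g).
Proof.
move=> endf endg; have [fM fV f1] := is_endP _ endf; have [gM gV g1] := is_endP _ endg.
apply/is_endP; split=> [u v Vu Vv|u Vu|u notVu]; rewrite !ffunE.
- by rewrite fM // gM ?fV.
- by rewrite is_end_mem.
- by rewrite f1 // is_end1.
Qed.

Lemma zero_adjoint : is_adjoint (zeroE Q) (zeroE Q).
Proof.
apply/is_adjointP; split=> [||u v Vu Vv]; rewrite ?zero_end //.
by rewrite !ffunE Bi1l ?Bi1r.
Qed.

Lemma one_adjoint : is_adjoint oneE oneE.
Proof.
apply/is_adjointP; split=> [||u v Vu Vv]; rewrite ?one_end //.
by rewrite !ffunE Vu Vv.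
Qed.

Lemma add_adjoint f f' g g' :
  is_adjoint f f' -> is_adjoint g g' -> is_adjoint (addE f g) (addE f' g').
Proof.
move=> /is_adjointP[ef ef' ff'] /is_adjointP[eg eg' gg'].
apply/is_adjointP; split=> [||u v Vu Vv]; rewrite ?add_end //.
by rewrite !ffunE BiMl ?BiMr ?is_end_mem // ff' ?gg'.
Qed.

Lemma opp_adjoint f f' : is_adjoint f f' -> is_adjoint (oppE f) (oppE f').
Proof.
move=> /is_adjointP[ef ef' ff'].
apply/is_adjointP; split=> [||u v Vu Vv]; rewrite ?opp_end //.
by rewrite !ffunE BiVl ?BiVr ?is_end_mem // ff'.
Qed.

Lemma mul_adjoint f f' g g' :
  is_adjoint f f' -> is_adjoint g g' -> is_adjoint (mulE f g) (mulE g' f').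
Proof.
move=> /is_adjointP[ef ef' ff'] /is_adjointP[eg eg' gg'].
apply/is_adjointP; split=> [||u v Vu Vv]; rewrite ?mul_end //.
by rewrite !ffunE gg' ?ff' ?is_end_mem.
Qed.

Lemma AdjP f : reflect (exists g, is_adjoint f g) (f \in Adj Q).
Proof.
rewrite inE; apply: (iffP andP) => [[_ /existsP//]|[g fg]].
by split; [case/is_adjointP: fg | apply/existsP; exists g].
Qed.

Lemma Adj_end f : f \in Adj Q -> is_end f.
Proof. by case/AdjP=> g /is_adjointP[]. Qed.

End AdjointRing.

(** * [Adj Q] as a finite ring with involution, and the translation of its *-ideals *)

Section AdjointRingType.
Import GRing.Theory.
Local Open Scope group_scope.
Variables (gT : finGroupType) (Q : {group gT}).

(** The equation is an argument of the type because the ring structure and the involution rest on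
    it, through bilinearity of the form and uniqueness of adjoints. *)
Definition adj_ring of Q^`(1) = 'Z(Q) := {f : endT Q | f \in Adj Q}.

Hypothesis derQ : Q^`(1) = 'Z(Q).
Local Notation R := (adj_ring derQ).
Local Notation V := (Vq Q).

HB.instance Definition _ := SubFinite.copy R {f : endT Q | f \in Adj Q}.

Implicit Types x y z : R.

Let adjE x : exists g, is_adjoint (val x) g.
Proof. exact/AdjP/(valP x). Qed.

Let endR x : is_end (val x). Proof. exact: Adj_end (valP x). Qed.

Fact zero_Adj : zeroE Q \in Adj Q.
Proof. by apply/AdjP; exists (zeroE Q); apply: zero_adjoint. Qed.

Fact one_Adj : oneE Q \in Adj Q.
Proof. by apply/AdjP; exists (oneE Q); apply: one_adjoint. Qed.

Fact add_Adj x y : addE (val x) (val y) \in Adj Q.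
Proof.
have [f xf] := adjE x; have [g yg] := adjE y.
by apply/AdjP; exists (addE f g); apply: add_adjoint.
Qed.

Fact opp_Adj x : oppE (val x) \in Adj Q.
Proof. by have [f xf] := adjE x; apply/AdjP; exists (oppE f); apply: opp_adjoint. Qed.

Fact mul_Adj x y : mulE (val x) (val y) \in Adj Q.
Proof.
have [f xf] := adjE x; have [g yg] := adjE y.
by apply/AdjP; exists (mulE g f); apply: mul_adjoint.
Qed.

Let zeroR : R := exist (fun f : endT Q => f \in Adj Q) _ zero_Adj.
Let oneR : R := exist (fun f : endT Q => f \in Adj Q) _ one_Adj.
Let addR x y : R := exist (fun f : endT Q => f \in Adj Q) _ (add_Adj x y).
Let oppR x : R := exist (fun f : endT Q => f \in Adj Q) _ (opp_Adj x).
Let mulR x y : R := exist (fun f : endT Q => f \in Adj Q) _ (mul_Adj x y).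

Let eqR x y : (forall u, u \in V -> val x u = val y u) -> x = y.
Proof. by move=> eq_xy; apply/val_inj/eq_end/eq_xy; apply: endR. Qed.

Let memR x u : val x u \in V. Proof. exact: is_end_mem. Qed.

Let addRA : associative addR.
Proof. by move=> x y z; apply: eqR => u _; rewrite !ffunE mulgA. Qed.
Let addRC : commutative addR.
Proof.
move=> x y; apply: eqR => u _; rewrite !ffunE.
exact: (centsP (Vq_abelian Q)).
Qed.
Let add0R : left_id zeroR addR.
Proof. by move=> x; apply: eqR => u _; rewrite !ffunE mul1g. Qed.
Let addNR : left_inverse zeroR oppR addR.
Proof. by move=> x; apply: eqR => u _; rewrite !ffunE mulVg. Qed.

HB.instance Definition _ := GRing.isZmodule.Build R addRA addRC add0R addNR.

Let mulRA : associative mulR.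
Proof. by move=> x y z; apply: eqR => u _; rewrite !ffunE. Qed.
Let mul1R : left_id oneR mulR.
Proof. by move=> x; apply: eqR => u Vu; rewrite !ffunE Vu. Qed.
Let mulR1 : right_id oneR mulR.
Proof. by move=> x; apply: eqR => u Vu; rewrite !ffunE memR. Qed.
Let mulRDl : left_distributive mulR +%R.
Proof.
move=> x y z; apply: eqR => u Vu; rewrite !ffunE.
by have [-> //] := is_endP _ (endR z); apply: memR.
Qed.
Let mulRDr : right_distributive mulR +%R.
Proof. by move=> x y z; apply: eqR => u Vu; rewrite !ffunE. Qed.

HB.instance Definition _ :=
  GRing.Zmodule_isPzRing.Build R mulRA mul1R mulR1 mulRDl mulRDr.

Definition adjoint_of (f : endT Q) : endT Q :=
  odflt (zeroE Q) [pick g | is_adjoint f g].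

Let adjoint_ofP x : is_adjoint (val x) (adjoint_of (val x)).
Proof.
rewrite /adjoint_of; case: pickP => [g|no_adj]; first by [].
exfalso.
by have [g] := adjE x; rewrite no_adj.
Qed.

Fact adjoint_Adj x : adjoint_of (val x) \in Adj Q.
Proof. by apply/AdjP; exists (val x); apply: is_adjoint_sym (adjoint_ofP x). Qed.

Let starR x : R := exist (fun f : endT Q => f \in Adj Q) _ (adjoint_Adj x).

Let starRE x y : is_adjoint (val x) (val y) -> starR x = y.
Proof. by move=> xy; apply/val_inj/(is_adjoint_inj derQ (adjoint_ofP x) xy). Qed.

Let starRD : {morph starR : x y / (x + y)%R}.
Proof. by move=> x y; apply: starRE; apply: add_adjoint; try exact: adjoint_ofP. Qed.
Let starRM x y : starR (x * y)%R = (starR y * starR x)%R.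
Proof. by apply: starRE; apply: mul_adjoint; try exact: adjoint_ofP. Qed.
Let starRK : involutive starR.
Proof. by move=> x; apply: starRE; apply: is_adjoint_sym; try exact: adjoint_ofP. Qed.

Definition adj_star : involution R := Involution starRD starRM starRK.

Lemma adj_starE x y : is_adjoint (val x) (val y) -> adj_star x = y.
Proof. exact: starRE. Qed.

Lemma adj_starP x : is_adjoint (val x) (val (adj_star x)).
Proof. exact: adjoint_ofP. Qed.

Lemma adj_add_val x y : val (x + y)%R = addE (val x) (val y). Proof. by []. Qed.
Lemma adj_opp_val x : val (- x)%R = oppE (val x). Proof. by []. Qed.
Lemma adj_mul_val x y : val (x * y)%R = mulE (val x) (val y). Proof. by []. Qed.
Lemma adj_zero_val : val (0 : R)%R = zeroE Q. Proof. by []. Qed.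
Lemma adj_one_val : val (1 : R)%R = oneE Q. Proof. by []. Qed.
Lemma adj_eq x y : (forall u, u \in V -> val x u = val y u) -> x = y.
Proof. exact: eqR. Qed.

Lemma adj_sum_val (T : finType) (D : {set T}) (E : T -> R) u :
  val (\sum_(t in D) E t)%R u = \prod_(t in D) val (E t) u.
Proof.
apply: (big_morph (fun x : R => val x u)) => [x y|].
  by rewrite adj_add_val ffunE.
by rewrite adj_zero_val ffunE.
Qed.

Lemma adj_nat_val n u : u \in V -> val (n%:R : R)%R u = u ^+ n.
Proof.
move=> Vu; elim: n => [|n IHn]; first by rewrite adj_zero_val ffunE.
by rewrite mulrS adj_add_val ffunE IHn adj_one_val ffunE Vu expgS.
Qed.

Lemma star_ideal_of_is_star_ideal I :
  is_star_ideal I -> star_ideal adj_star [set x : R | val x \in I].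
Proof.
case/andP=> /and5P[sIA I0 ID IN IM] IS; apply/star_idealP.
split=> [|x y|x y|x y|x]; rewrite !inE => // Ix.
- move=> Iy; rewrite adj_add_val adj_opp_val.
  exact: (forall_inP (forall_inP ID _ Ix)) (forall_inP IN _ Iy).
- by have /andP[] := forall_inP (forall_inP IM _ (valP x)) _ Ix.
- by have /andP[] := forall_inP (forall_inP IM _ (valP x)) _ Ix.
- exact: (implyP (forallP (forall_inP IS _ Ix) _) (adj_starP x)).
Qed.

Lemma is_star_ideal_of_star_ideal (J : {set R}) :
  star_ideal adj_star J -> is_star_ideal [set val x | x in J].
Proof.
case/star_idealP=> J0 JB JM JMr JS.
have JN x : x \in J -> (- x)%R \in J by rewrite -sub0r; apply: JB.
apply/andP; split; last first.
  apply/forall_inP=> _ /imsetP[x Jx ->]; apply/forallP=> g; apply/implyP=> xg.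
  apply/imsetP; exists (adj_star x); first exact: JS.
  exact: (is_adjoint_inj derQ xg (adj_starP x)).
apply/and5P; split.
- by apply/subsetP=> _ /imsetP[x _ ->]; apply: valP.
- by apply/imsetP; exists 0%R.
- apply/forall_inP=> _ /imsetP[x Jx ->]; apply/forall_inP=> _ /imsetP[y Jy ->].
  apply/imsetP; exists (x + y)%R => //.
  by rewrite -[y]opprK JB ?JN.
- apply/forall_inP=> _ /imsetP[x Jx ->].
  by apply/imsetP; exists (- x)%R; first exact: JN.
- apply/forall_inP=> a Aa; apply/forall_inP=> _ /imsetP[x Jx ->].
  pose r : R := exist _ a Aa.
  apply/andP; split; apply/imsetP; [exists (r * x)%R|exists (x * r)%R] => //.
    exact: JM.
  exact: JMr.
Qed.

Let val_ideal (I : {set endT Q}) : is_star_ideal I ->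
  [set val x | x in [set x : R | val x \in I]] = I.
Proof.
case/andP=> /and5P[/subsetP sIA _ _ _ _] _; apply/setP=> f.
apply/imsetP/idP => [[x]|If]; first by rewrite inE => Ix ->.
by exists (exist _ f (sIA f If) : R); rewrite ?inE.
Qed.

Let pre_ideal (J : {set R}) : [set x : R | val x \in [set val y | y in J]] = J.
Proof. by apply/setP=> x; rewrite inE mem_imset //; apply: val_inj. Qed.

Let proper_ideal (I : {set endT Q}) : is_star_ideal I ->
  (I != Adj Q) = (1%R \notin [set x : R | val x \in I]).
Proof.
move=> idI; congr (~~ _); apply/eqP/idP => [->|I1]; first by rewrite inE one_Adj.
have [_ _ IM _ _] := star_idealP _ _ (star_ideal_of_is_star_ideal idI).
apply/eqP; rewrite eqEsubset; case/andP: (idI) => /and5P[-> _ _ _ _] _ /=.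
apply/subsetP=> f Af; have := IM (exist _ f Af) _ I1.
by rewrite mulr1 inE.
Qed.

Lemma max_star_ideal_of_mem I :
  I \in max_star_ideals Q -> max_star_ideal adj_star [set x : R | val x \in I].
Proof.
rewrite inE => /and3P[idI nI maxI]; apply/max_star_idealP.
split=> [||J idJ J1 sIJ]; first exact: star_ideal_of_is_star_ideal.
  by rewrite -proper_ideal.
have idvJ := is_star_ideal_of_star_ideal idJ.
rewrite -[J]pre_ideal; suff -> : [set val x | x in J] = I by [].
apply/eqP/(implyP (forallP maxI _)); rewrite idvJ proper_ideal // pre_ideal J1.
by rewrite -[I]val_ideal // imsetS.
Qed.

Lemma mem_max_star_ideals (J : {set R}) :
  max_star_ideal adj_star J -> [set val x | x in J] \in max_star_ideals Q.
Proof.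
case/max_star_idealP=> idJ J1 maxJ; have idvJ := is_star_ideal_of_star_ideal idJ.
rewrite inE idvJ proper_ideal // pre_ideal J1; apply/forallP=> I.
apply/implyP=> /and3P[idI nI sJI]; rewrite -(val_ideal idI); apply/eqP.
suff -> : [set x : R | val x \in I] = J by [].
apply/maxJ; rewrite ?star_ideal_of_is_star_ideal -?proper_ideal //.
apply/subsetP=> x Jx; rewrite inE (subsetP sJI) //; exact: imset_f.
Qed.

End AdjointRingType.

(** * Central decompositions *)

Section CentralProjection.
Local Open Scope group_scope.
Variables (gT : finGroupType) (Q A C : {group gT}).
Hypotheses (derQ : Q^`(1) = 'Z(Q)) (cAC : C \subset 'C(A)) (defQ : A * C = Q).
Hypothesis sDC : Q^`(1) \subset C.
Local Notation V := (Vq Q).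

Definition central_proj : endT Q :=
  [ffun u => if u \in V then divgr (A / Q^`(1)) (C / Q^`(1)) u else 1].

Let sAQ : A \subset Q. Proof. by rewrite -defQ mulG_subl. Qed.
Let sCQ : C \subset Q. Proof. by rewrite -defQ mulG_subr. Qed.

Let VA u : u \in A / Q^`(1) -> u \in V.
Proof. exact/subsetP/quotientS. Qed.
Let VC u : u \in C / Q^`(1) -> u \in V.
Proof. exact/subsetP/quotientS. Qed.

(** What lies in both [A] and [C] commutes with [A * C = Q], hence lies in [Z(Q) = Q']. *)
Let tiAC : A / Q^`(1) :&: C / Q^`(1) = 1.
Proof.
rewrite -quotientIG //; apply/trivgP; rewrite quotient_sub1; last first.
  by rewrite (subset_trans (subsetIl _ _)) // (subset_trans sAQ) // der_norm.
suff: A :&: C \subset 'Z(Q) by rewrite -derQ.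
rewrite subsetI (subset_trans (subsetIl _ _)) //=.
rewrite -defQ centM subsetI (subset_trans (subsetIr _ _)) //=.
by rewrite (subset_trans (subsetIl _ _)) // centsC.
Qed.

Let V_AC u : u \in V -> exists a c, [/\ a \in A / Q^`(1), c \in C / Q^`(1) & u = a * c].
Proof.
case/(Vq_coset)=> q Qq ->; have : q \in A * C by rewrite defQ.
case/mulsgP=> a c Aa Cc ->; exists (coset Q^`(1) a), (coset Q^`(1) c).
rewrite !mem_quotient // morphM //.
  by rewrite (subsetP (der_norm 1 Q)) // (subsetP sAQ).
by rewrite (subsetP (der_norm 1 Q)) // (subsetP sCQ).
Qed.

Lemma central_projM a c :
  a \in A / Q^`(1) -> c \in C / Q^`(1) -> central_proj (a * c) = a.
Proof.
move=> Aa Cc; have Vac : a * c \in V := groupM (VA Aa) (VC Cc).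
by rewrite ffunE Vac divgrMid.
Qed.

Lemma central_proj_id a : a \in A / Q^`(1) -> central_proj a = a.
Proof. by move=> Aa; rewrite -{1}[a]mulg1 central_projM ?group1. Qed.

Lemma central_proj1 c : c \in C / Q^`(1) -> central_proj c = 1.
Proof. by move=> Cc; rewrite -{1}[c]mul1g central_projM ?group1. Qed.

Lemma mem_central_proj u : central_proj u \in A / Q^`(1).
Proof.
have [Vu|notVu] := boolP (u \in V); last by rewrite ffunE (negPf notVu) group1.
by have [a [c [Aa Cc ->]]] := V_AC Vu; rewrite central_projM.
Qed.

Lemma central_proj_end : is_end central_proj.
Proof.
apply/is_endP; split=> [u v|u Vu|u /negPf notVu]; last by rewrite ffunE notVu.
  move=> /V_AC[a [c [Aa Cc ->]]] /V_AC[a' [c' [Aa' Cc' ->]]].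
  have -> : a * c * (a' * c') = a * a' * (c * c').
    have ca' : commute c a' := centsP (Vq_abelian Q) c (VC Cc) a' (VA Aa').
    by rewrite !mulgA -(mulgA a) ca' !mulgA.
  by rewrite !central_projM ?(groupM Aa Aa') ?(groupM Cc Cc').
exact/VA/mem_central_proj.
Qed.

(** The images of [A] and [C] are orthogonal, so both sides reduce to the form evaluated on the two
    [A]-components. *)
Lemma central_proj_adjoint : is_adjoint central_proj central_proj.
Proof.
have B_AC a c : a \in A / Q^`(1) -> c \in C / Q^`(1) -> Bi a c = 1.
  case/morphimP=> x _ Ax ->; case/morphimP=> y _ Cy ->.
  rewrite (BiE derQ (subsetP sAQ x Ax) (subsetP sCQ y Cy)).
  by have /commgP/eqP-> : commute x y by apply/commute_sym/(centsP cAC).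
apply/is_adjointP; split=> [||u v]; try exact: central_proj_end.
move=> /V_AC[a [c [Aa Cc ->]]] /V_AC[a' [c' [Aa' Cc' ->]]].
have Va := VA Aa; have Vc := VC Cc; have Va' := VA Aa'; have Vc' := VC Cc'.
rewrite !central_projM // (BiMl derQ Va Vc Va') (BiMr derQ Va Va' Vc') (B_AC a c') // mulg1.
by rewrite (Bi_sym derQ (VA Aa') (VC Cc)) (B_AC a' c) // invg1 mulg1.
Qed.

End CentralProjection.

(** * Consequences of central indecomposability *)

Section CentralDecompositions.
Local Open Scope group_scope.
Variable gT : finGroupType.
Implicit Types (G H A B X Y : {group gT}) (S : {set {group gT}}).

Lemma sub_gen_of S X : X \in S -> X \subset gen_of S.
Proof. by move=> SX; rewrite sub_gen ?(bigcup_max X). Qed.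

Lemma gen_of_subG S G : (gen_of S \subset G) = [forall X in S, X \subset G].
Proof.
rewrite gen_subG; apply/bigcupsP/forall_inP; exact.
Qed.

Lemma central_decompP G S :
  reflect [/\ gen_of S = G,
              forall X Y, X \in S -> Y \in S -> X != Y -> X \subset 'C(Y)
            & forall S', S' \proper S -> gen_of S' <> G]
          (central_decomp G S).
Proof.
apply: (iffP and3P) => [[/eqP genS cS minS]|[genS cS minS]]; split=> //.
- move=> X Y SX SY; exact: (implyP (forall_inP (forall_inP cS X SX) Y SY)).
- by move=> S' /(implyP (forallP minS S'))/eqP.
- exact/eqP.
- apply/forall_inP=> X SX; apply/forall_inP=> Y SY; apply/implyP; exact: cS.
- by apply/forallP=> S'; apply/implyP=> /minS/eqP.
Qed.

Lemma indecomposable_joing H A B :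
    centrally_indecomposable H -> A \subset 'C(B) -> A <*> B = H ->
  A :=: H \/ B :=: H.
Proof.
move=> indecH cAB defH.
have [->|neqAH] := eqVneq A H; first by left.
have [->|neqBH] := eqVneq B H; first by right.
suff: central_decomp H [set A; B].
  move/(implyP (forallP indecH _))/eqP/setP/(_ A).
  by rewrite !inE eqxx (negPf neqAH).
have sAH : A \subset H by rewrite -defH joing_subl.
have sBH : B \subset H by rewrite -defH joing_subr.
apply/central_decompP; split.
- by rewrite -defH /gen_of bigcup_setU !big_set1.
- move=> X Y /set2P[]-> /set2P[]->; rewrite ?eqxx // => _.
  by rewrite centsC.
- move=> S' /properP[/subsetP sS' [X AB_X notS'X]] genS'.
  (* A proper subset of the pair has all its members equal to [A] or all equal to [B]; the empty
     subset is covered too. *)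
  have sub Y : (forall X', X' \in S' -> X' = Y) -> H \subset Y.
    move=> S'Y; rewrite -genS' gen_of_subG; apply/forall_inP=> X' /S'Y->.
    exact: subxx.
  case/set2P: AB_X notS'X => -> notS'.
    case/negP: neqBH; rewrite -val_eqE /= eqEsubset sBH; apply: sub => X' S'X'.
    by case/set2P: (sS' _ S'X') => // eqX; rewrite eqX (negPf notS') in S'X'.
  case/negP: neqAH; rewrite -val_eqE /= eqEsubset sAH; apply: sub => X' S'X'.
  by case/set2P: (sS' _ S'X') => // eqX; rewrite eqX (negPf notS') in S'X'.
Qed.

(** With exponent dividing [p], the Frattini subgroup of [H] is [H'], so some maximal subgroup [M]
    misses [z]. Then [H] is generated by [M] and the central [<[z]>], and indecomposability leaves
    only [<[z]>]. *)
Lemma indecomposable_center_cycle (p : nat) H z :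
    p.-group H -> exponent H %| p -> centrally_indecomposable H ->
  z \in 'Z(H) -> z \notin H^`(1) -> H :=: <[z]>.
Proof.
move=> pH expH indecH Zz notH'z; have [Hz cHz] := setIP Zz.
have Mho1 : 'Mho^1(H) = 1.
  rewrite (MhoE 1%N pH); apply/trivgP; rewrite gen_subG; apply/subsetP=> _ /imsetP[x Hx ->].
  by rewrite expn1 inE -order_dvdn (dvdn_trans (dvdn_exponent Hx)).
have : z \notin 'Phi(H) by rewrite (Phi_joing pH) Mho1 joingG1.
move=> notPhi; have [M maxM notMz] : exists2 M : {group gT}, maximal M H & z \notin M.
  have : [exists M : {group gT}, maximal_eq M H && (z \notin M)].
    apply: contraR notPhi; rewrite negb_exists => /forallP notM.
    apply/bigcapP=> M maxM; apply: contraT => notMz.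
    by have := notM M; rewrite maxM notMz.
  case/existsP=> M /andP[/orP[/eqP eqMH|maxM] notMz]; last by exists M.
  by rewrite eqMH Hz in notMz.
have sZH : <[z]> \subset H by rewrite cycle_subG.
have cMZ : M \subset 'C(<[z]>).
  by rewrite cent_cycle (subset_trans (proper_sub (maxgroupp maxM))) // sub_cent1.
have defH : M <*> <[z]> = H.
  rewrite cent_joinEr 1?centsC // (mulg_normal_maximal _ maxM) ?cycle_subG //.
  exact: p_maximal_normal pH maxM.
have [eqMH|<-//] := indecomposable_joing indecH cMZ defH.
by rewrite eqMH Hz in notMz.
Qed.

End CentralDecompositions.

(** * Structure of a fully refined decomposition *)

Section ClassTwo.
Local Open Scope group_scope.
Variables (gT : finGroupType) (p : nat) (P : {group gT}).
Hypotheses (p_pr : prime p) (pP : p.-group P).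
Hypotheses (expP : exponent P %| p) (clP : P^`(1) \subset 'Z(P)).
Implicit Types (X Y : {group gT}) (S : {set {group gT}}).

(** [Qof P S] with its group structure. *)
Definition Qgroup S : {group gT} := <<\bigcup_(X in Kpart P S) X>>%G.

Section FullyRefined.
Variable S : {set {group gT}}.
Hypothesis refS : fully_refined P S.
Local Notation K := (Kpart P S).
Local Notation Q := (Qgroup S).
Local Notation Z := 'Z(P).

Let gen_S : gen_of S = P.
Proof. by case/andP: refS => /central_decompP[]. Qed.

Let cS X Y : X \in S -> Y \in S -> X != Y -> X \subset 'C(Y).
Proof. by case/andP: refS => /central_decompP[_ cS _] _; apply: cS. Qed.

Let minS S' : S' \proper S -> gen_of S' <> P.
Proof. by case/andP: refS => /central_decompP[_ _ minS] _; apply: minS. Qed.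

Lemma refined_indecomposable X : X \in S -> centrally_indecomposable X.
Proof. by case/andP: refS => _ /forall_inP; apply. Qed.

Lemma refined_sub X : X \in S -> X \subset P.
Proof. by move=> SX; rewrite -gen_S sub_gen_of. Qed.

Lemma KpartP X : reflect (X \in S /\ ~~ (X \subset Z)) (X \in K).
Proof.
rewrite !inE; apply: (iffP andP) => [[]|[SX notZ]]; last by rewrite SX notZ.
by move=> + SX; rewrite SX.
Qed.

Lemma Kpart_sub X : X \in K -> X \subset Q.
Proof. exact: sub_gen_of. Qed.

Lemma Kpart_cent X Y : X \in K -> Y \in K -> X != Y -> X \subset 'C(Y).
Proof. by case/KpartP=> SX _ /KpartP[SY _]; apply: cS. Qed.

Lemma sub_Qgroup : Q \subset P.
Proof.
rewrite gen_subG; apply/bigcupsP=> X /KpartP[SX _]; exact: refined_sub.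
Qed.

Lemma refined_abelian X : X \in S -> abelian X -> X \subset Z.
Proof.
move=> SX abX; rewrite subsetI refined_sub //= centsC -gen_S.
rewrite (gen_of_subG _ 'C(X)); apply/forall_inP=> Y SY.
by have [->|neq] := eqVneq Y X; last exact: cS.
Qed.

Lemma refined_center_cycle X z :
  X \in S -> z \in 'Z(X) -> z \notin X^`(1) -> X :=: <[z]>.
Proof.
move=> SX; apply: (@indecomposable_center_cycle _ p).
- exact: pgroupS (refined_sub SX) pP.
- exact: dvdn_trans (exponentS (refined_sub SX)) expP.
- exact: refined_indecomposable.
Qed.

(** Otherwise [X] would be cyclic, hence abelian, and an abelian member is central in [P]. *)
Lemma Kpart_center X : X \in K -> 'Z(X) \subset X^`(1).
Proof.
case/KpartP=> SX notZ; apply/subsetP=> z Zz; apply: contraR notZ => notX'z.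
apply: refined_abelian => //; rewrite (refined_center_cycle SX Zz notX'z).
exact: cycle_abelian.
Qed.

Lemma Qgroup_cprod : \big[cprod/1]_(X in K) (X : {set gT}) = Q.
Proof.
apply/eqP; have /bigcprodYP : forall X Y, X \in K -> Y \in K -> X != Y -> X \subset 'C(Y).
  exact: Kpart_cent.
by rewrite bigprodGE.
Qed.

Lemma center_cent_Qgroup : Z \subset 'C(Q).
Proof. exact: subset_trans (subsetIr _ _) (centS sub_Qgroup). Qed.

(** The centre of a central product is the product of the centres of its factors, each inside the
    derived subgroup of its factor by [Kpart_center]. The other inclusion is class 2. *)
Lemma Qgroup_center_der : Q^`(1) = 'Z(Q).
Proof.
apply/eqP; rewrite eqEsubset; apply/andP; split.
  rewrite subsetI der_sub /=; apply: subset_trans (dergS 1 sub_Qgroup) _.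
  exact: subset_trans clP center_cent_Qgroup.
rewrite -(bigcprodW (center_bigcprod Qgroup_cprod)).
elim/big_ind: _ => [|A B sA sB|X KX]; first exact: sub1G.
  exact: mul_subG.
exact: subset_trans (Kpart_center KX) (dergS 1 (Kpart_sub KX)).
Qed.

Lemma Qgroup_mul_center : Q * Z = P.
Proof.
apply/eqP; rewrite -cent_joinEr ?center_cent_Qgroup // eqEsubset join_subG sub_Qgroup center_sub /=.
rewrite -{1}gen_S (gen_of_subG _ (Q <*> Z)); apply/forall_inP=> X SX.
have [ZX|notZX] := boolP (X \subset Z); first by rewrite (subset_trans ZX) ?joing_subr.
apply: subset_trans (joing_subl _ _); apply: Kpart_sub; exact/KpartP.
Qed.

Lemma Qgroup_center_sub : Q :&: Z \subset 'Z(Q).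
Proof.
rewrite subsetI subsetIl /= (subset_trans (subsetIr _ _)) //.
exact: center_cent_Qgroup.
Qed.

Lemma Qgroup_der : Q^`(1) = P^`(1).
Proof.
have /(der_cprod 1) : Q \* Z = P.
  by rewrite cprodE ?center_cent_Qgroup // Qgroup_mul_center.
have /derG1P -> : abelian Z by exact: center_abelian.
by rewrite cprodg1.
Qed.

(** The centre is the direct product of [P'] and the central members, each of which has order
    [p]. *)
Lemma card_Zpart : #|Z| = (#|P^`(1)| * p ^ #|Zpart P S|)%N.
Proof.
have ZpartP X : reflect (X \in S /\ X \subset Z) (X \in Zpart P S).
  by rewrite inE; apply: andP.
have sZZ X : X \in Zpart P S -> X \subset Z by case/ZpartP.
have drop X (G : {group gT}) : X \in S -> X \subset G -> G \subset P ->
    (forall Y, Y \in S -> Y != X -> Y \subset G) -> G :=: P.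
  move=> SX sXG sGP sSG; apply/eqP; rewrite eqEsubset sGP -gen_S gen_of_subG.
  apply/forall_inP=> Y SY; have [->//|] := eqVneq Y X; exact: sSG.
have gen_drop X : X \in S -> ~~ (X \subset <<\bigcup_(Y in S :\ X) Y>>).
  move=> SX; apply/negP=> sX; apply: (@minS (S :\ X)); first exact: properD1.
  apply: drop sX _ _ => // [|Y SY neqYX].
    rewrite gen_subG; apply/bigcupsP=> Y /setD1P[_]; exact: refined_sub.
  by rewrite sub_gen_of // !inE neqYX.
have cardX X : X \in Zpart P S -> #|X| = p.
  case/ZpartP=> SX sXZ.
  have abX : abelian X by rewrite (abelianS sXZ) ?center_abelian.
  have [X1|/trivgPn[z Xz z_neq1]] := eqVneq (X : {set gT}) 1.
    by case/negP: (gen_drop X SX); rewrite X1 sub1G.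
  have -> : X :=: <[z]>.
    apply: refined_center_cycle; rewrite ?(center_idP abX) //.
    by rewrite (derG1P abX) inE.
  rewrite -orderE; apply/(prime_nt_dvdP p_pr); first by rewrite order_eq1.
  exact: dvdn_trans (dvdn_exponent (subsetP (refined_sub SX) _ Xz)) expP.
have genT_Z (T : {set {group gT}}) : T \subset Zpart P S ->
    <<\bigcup_(X in T) X>> \subset Z.
  move=> sTZ; rewrite gen_subG; apply/bigcupsP=> X /(subsetP sTZ); exact: sZZ.
have card_T n (T : {set {group gT}}) : #|T| = n -> T \subset Zpart P S ->
    #|P^`(1) <*> <<\bigcup_(X in T) X>>| = (#|P^`(1)| * p ^ n)%N.
  elim: n T => [|n IHn] T cardT sTZ.
    by rewrite (cards0_eq cardT) big_set0 gen0 joingG1 muln1.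
  have /set0Pn[X TX] : T != set0 by rewrite -card_gt0 cardT.
  have ZX := subsetP sTZ X TX; have [SX sXZ] := ZpartP X ZX.
  have sT'Z : T :\ X \subset Zpart P S := subset_trans (subD1set T X) sTZ.
  have cardT' : #|T :\ X| = n by apply: succn_inj; rewrite -cardT (cardsD1 X T) TX.
  set G := (P^`(1) <*> <<\bigcup_(Y in T :\ X) Y>>)%G.
  have cGX : X \subset 'C(G).
    rewrite (subset_trans sXZ) // (subset_trans (subsetIr _ _)) // centS //.
    by rewrite join_subG der_sub (subset_trans (genT_Z _ sT'Z)) ?center_sub.
  have tiXG : X :&: G = 1.
    apply: prime_TIg; first by rewrite cardX.
    (* [P' = Q'] lies in the group generated by the noncentral members, so all of [G] is generated
       within the members other than [X]. *)
    apply: contra (gen_drop X SX) => /subset_trans-> //.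
    rewrite join_subG -Qgroup_der (subset_trans (der_sub 1 Q)) /=; last first.
      rewrite genS //; apply/bigcupsP=> Y /KpartP[SY notZY].
      rewrite (bigcup_max Y) // !inE SY andbT.
      by apply: contraNneq notZY => ->.
    rewrite genS //; apply/bigcupsP=> Y /setD1P[neqYX /(subsetP sTZ)/ZpartP[SY _]].
    by rewrite (bigcup_max Y) // !inE neqYX.
  have -> : P^`(1) <*> <<\bigcup_(Y in T) Y>> = G * X.
    rewrite -cent_joinEr //= -joingA; congr (_ <*> _).
    by rewrite joing_idl joingE (big_setD1 X) //= setUC.
  rewrite setIC in tiXG; rewrite TI_cardMg // (cardX X ZX) (IHn _ cardT' sT'Z).
  by rewrite expnSr mulnA.
rewrite -(card_T _ (Zpart P S)) //; congr #|pred_of_set _|.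
apply/eqP; rewrite eqEsubset join_subG clP genT_Z // !andbT.
apply/subsetP=> z Zz; have Pz : z \in P by case/setIP: Zz.
have defP : Q * <<\bigcup_(X in Zpart P S) X>> = P.
  have cQZ : <<\bigcup_(X in Zpart P S) X>> \subset 'C(Q).
    exact: subset_trans (genT_Z _ (subxx _)) center_cent_Qgroup.
  rewrite -cent_joinEr //; apply/eqP; rewrite eqEsubset join_subG sub_Qgroup.
  rewrite (subset_trans (genT_Z _ (subxx _))) ?center_sub //= -{1}gen_S gen_of_subG.
  apply/forall_inP=> X SX; have [sXZ|notXZ] := boolP (X \subset Z).
    apply: subset_trans (joing_subr _ _).
    by rewrite sub_gen ?(bigcup_max X) //; apply/ZpartP.
  by apply: subset_trans (joing_subl _ _); apply/Kpart_sub/KpartP.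
(* Here [q = z * w^-1] is in [Q] and central in [P], hence in [Z(Q) = Q' = P']. *)
have /mulsgP[q w Qq Ww def_z] : z \in Q * <<\bigcup_(X in Zpart P S) X>> by rewrite defP.
rewrite def_z groupM ?(subsetP (joing_subr _ _) w) //.
apply: (subsetP (joing_subl _ _)).
rewrite -Qgroup_der Qgroup_center_der (subsetP Qgroup_center_sub) // inE Qq.
have -> : q = z * w^-1 by rewrite def_z mulgK.
by rewrite groupM ?groupV // (subsetP (genT_Z _ (subxx _))).
Qed.

End FullyRefined.
End ClassTwo.

(** * Any decomposition [S] gives a frame in the ring of adjoints fixed by [S0] *)

Section Frame.
Local Open Scope group_scope.
Variables (gT : finGroupType) (p : nat) (P : {group gT}).
Hypotheses (p_pr : prime p) (pP : p.-group P).
Hypotheses (expP : exponent P %| p) (clP : P^`(1) \subset 'Z(P)).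
Implicit Types (X Y : {group gT}).

Variables S0 S : {set {group gT}}.
Hypotheses (refS0 : fully_refined P S0) (refS : fully_refined P S).
Local Notation Q := (Qgroup P S0).
Local Notation K := (Kpart P S).
Local Notation Z := 'Z(P).
Local Notation D := Q^`(1).
Local Notation V := (Vq Q).

Let derQ : D = 'Z(Q) := Qgroup_center_der pP expP clP refS0.

(* X and its trace in Q have the same image in P / Z(P), so members of two
   decompositions can be compared inside one ring of adjoints. *)
Definition trace X : {group gT} := ((X <*> Z) :&: Q)%G.
Definition cotrace X : {group gT} := (<<\bigcup_(Y in K :\ X) trace Y>> <*> D)%G.

Let QZ_P : Q * Z = P. Proof. exact: Qgroup_mul_center refS0. Qed.
Let sQP : Q \subset P. Proof. exact: sub_Qgroup refS0. Qed.
Let sDZ : D \subset Z. Proof. exact: subset_trans (dergS 1 sQP) clP. Qed.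
Let sKP X : X \in K -> X \subset P.
Proof. by case/KpartP=> SX _; apply: refined_sub refS _ SX. Qed.

Let QZ_D x : x \in Q -> x \in Z -> x \in D.
Proof.
by move=> Qx Zx; rewrite derQ (subsetP (Qgroup_center_sub refS0)) // inE Qx.
Qed.

Let P_QZ x : x \in P -> exists q z, [/\ q \in Q, z \in Z & x = q * z].
Proof.
move=> Px; have /mulsgP[q z Qq Zz ->] : x \in Q * Z by rewrite QZ_P.
by exists q, z.
Qed.

Let cent_Z x z : x \in P -> z \in Z -> commute x z.
Proof. by move=> Px /centerP[_ cz]; apply/commute_sym/cz. Qed.

Let joinZ (G : {group gT}) : G \subset P -> G <*> Z = G * Z.
Proof. by move=> sGP; rewrite cent_joinEr // centsC (subset_trans sGP) // centsC subsetIr. Qed.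

Lemma sub_trace X : trace X \subset Q. Proof. exact: subsetIr. Qed.

Lemma der_sub_trace X : D \subset trace X.
Proof. by rewrite subsetI der_sub (subset_trans sDZ) ?joing_subr. Qed.

Lemma trace_decomp X q : X \in K -> q \in trace X ->
  exists x z, [/\ x \in X, z \in Z & q = x * z].
Proof.
move=> KX /setIP[]; rewrite /= joinZ ?sKP // => /mulsgP[x z Xx Zz ->] _.
by exists x, z.
Qed.

Lemma mem_trace X x z q :
  x \in X -> z \in Z -> q \in Q -> q = x * z -> q \in trace X.
Proof.
move=> Xx Zz Qq def_q; rewrite inE Qq andbT def_q.
by rewrite groupM ?mem_gen // inE ?Xx ?Zz ?orbT.
Qed.

Lemma trace_cent X Y : X \in K -> Y \in K -> X != Y -> trace X \subset 'C(trace Y).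
Proof.
move=> KX KY neqXY; apply/centsP=> q /(trace_decomp KX)[x [z [Xx Zz ->]]].
move=> _ /(trace_decomp KY)[y [t [Yy Zt ->]]].
have Px := subsetP (sKP KX) x Xx; have Py := subsetP (sKP KY) y Yy.
have Pz := subsetP (center_sub P) z Zz; have Pt := subsetP (center_sub P) t Zt.
have xy : commute x y := centsP (Kpart_cent refS KX KY neqXY) x Xx y Yy.
apply: commuteM; last by apply: cent_Z; rewrite ?groupM.
by apply/commute_sym/commuteM; [apply: commute_sym | apply: cent_Z].
Qed.

(** Modulo [Z(P)] the traces cover the members of [K], so [G :&: Q] and [Z(P)] generate [P]. An
    element of [Q] is then [g * z] with [z] in both [Q] and [Z(P)], hence in [D]. *)
Lemma trace_gen (G : {group gT}) :
  D \subset G -> (forall X, X \in K -> trace X \subset G) -> Q \subset G.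
Proof.
move=> sDG sKG; pose H := ((G :&: Q) <*> Z)%G.
have sGQ : G :&: Q \subset P := subset_trans (subsetIr _ _) sQP.
have sPH : P \subset H.
  rewrite -(Qgroup_mul_center refS) mul_subG ?joing_subr // gen_subG.
  apply/bigcupsP=> X KX; apply/subsetP=> x Xx.
  have [q [z [Qq Zz def_x]]] := P_QZ (subsetP (sKP KX) x Xx).
  have def_q : q = x * z^-1 by rewrite def_x mulgK.
  have Tq : q \in trace X by apply: mem_trace Xx _ Qq def_q; rewrite groupV.
  rewrite def_x groupM ?(subsetP (joing_subr _ _) z) //.
  by rewrite (subsetP (joing_subl _ _)) // inE Qq (subsetP (sKG X KX)).
apply/subsetP=> q Qq; have := subsetP sPH q (subsetP sQP q Qq).
rewrite /= joinZ // => /mulsgP[g z /setIP[Gg Qg] Zz def_q].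
have def_z : z = g^-1 * q by rewrite def_q mulKg.
have Dz : z \in D by apply: QZ_D; rewrite // def_z groupM ?groupV.
by rewrite def_q groupM // (subsetP sDG).
Qed.

Lemma der_sub_cotrace X : D \subset cotrace X.
Proof. exact: joing_subr. Qed.

Lemma trace_sub_cotrace X Y : Y \in K -> Y != X -> trace Y \subset cotrace X.
Proof.
move=> KY neqYX; apply: subset_trans (joing_subl _ _).
by rewrite sub_gen // (bigcup_max Y) // in_setD1 neqYX.
Qed.

Lemma cotrace_cent X : X \in K -> cotrace X \subset 'C(trace X).
Proof.
move=> KX; rewrite join_subG gen_subG; apply/andP; split.
  by apply/bigcupsP=> Y /setD1P[neqYX KY]; apply: trace_cent.
apply: subset_trans sDZ _; apply: subset_trans (subsetIr P 'C(P)) (centS _).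
exact: subset_trans (sub_trace X) sQP.
Qed.

Lemma cotrace_sub X : cotrace X \subset Q.
Proof.
rewrite join_subG gen_subG der_sub andbT; apply/bigcupsP=> Y _; exact: sub_trace.
Qed.

Lemma trace_mul_cotrace X : X \in K -> trace X * cotrace X = Q.
Proof.
move=> KX; rewrite -cent_joinEr ?cotrace_cent //.
apply/eqP; rewrite eqEsubset join_subG sub_trace cotrace_sub /=.
apply: (@trace_gen (trace X <*> cotrace X)%G) => [|Y KY].
  exact: subset_trans (der_sub_trace X) (joing_subl _ _).
have [->|neqYX] := eqVneq Y X; first exact: joing_subl.
exact: subset_trans (trace_sub_cotrace KY neqYX) (joing_subr _ _).
Qed.

(** The elements of [Q] on whose cosets [f] and [g] agree form a group, to which [trace_gen]
    applies. *)
Lemma eq_end_trace (f g : endT Q) : is_end f -> is_end g ->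
    (forall X u, X \in K -> u \in trace X / D -> f u = g u) -> f = g.
Proof.
move=> endf endg eq_fg; apply: eq_end => // _ /(Vq_coset)[q Qq ->].
have [fM _ _] := is_endP _ endf; have [gM _ _] := is_endP _ endg.
have NQ x : x \in Q -> x \in 'N(D) := subsetP (der_norm 1 Q) x.
pose E := [set x in Q | f (coset D x) == g (coset D x)].
have groupE : group_set E.
  apply/group_setP; split=> [|x y]; rewrite !inE.
    by rewrite group1 morph1 !is_end1 ?eqxx.
  move=> /andP[Qx /eqP fx] /andP[Qy /eqP fy].
  rewrite groupM // morphM ?NQ // fM ?gM ?mem_quotient // fx fy eqxx //.
suff /subsetP/(_ q Qq) : Q \subset Group groupE by rewrite inE => /andP[_ /eqP].
apply: trace_gen => [|X KX]; apply/subsetP=> x.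
  move=> Dx; rewrite inE (subsetP (der_sub 1 Q)) //=.
  by rewrite coset_id // !is_end1.
move=> Tx; rewrite inE (subsetP (sub_trace X)) //=; apply/eqP.
by apply: eq_fg KX _; apply: mem_quotient.
Qed.

Local Notation R := (adj_ring derQ).

(** [insubd] makes this a total function of [X], as [star_frame] requires; for [X] in [K] the value
    is the projection. *)
Definition frame_proj X : R :=
  insubd (0 : R)%R (central_proj Q (trace X) (cotrace X)).

Lemma val_frame_proj X : X \in K ->
  val (frame_proj X) = central_proj Q (trace X) (cotrace X).
Proof.
move=> KX; rewrite insubdK //; apply/AdjP.
exists (central_proj Q (trace X) (cotrace X)).
exact: central_proj_adjoint derQ (cotrace_cent KX) (trace_mul_cotrace KX)
  (der_sub_cotrace X).
Qed.

Lemma frame_proj_adjoint X : X \in K ->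
  is_adjoint (val (frame_proj X)) (val (frame_proj X)).
Proof.
move=> KX; rewrite val_frame_proj //.
exact: central_proj_adjoint derQ (cotrace_cent KX) (trace_mul_cotrace KX)
  (der_sub_cotrace X).
Qed.

Lemma frame_proj_end X : is_end (val (frame_proj X)).
Proof. exact: Adj_end (valP _). Qed.

Lemma frame_proj_mem X u : X \in K -> val (frame_proj X) u \in trace X / D.
Proof.
move=> KX; rewrite val_frame_proj //.
exact: mem_central_proj derQ (cotrace_cent KX) (trace_mul_cotrace KX)
  (der_sub_cotrace X) u.
Qed.

Lemma frame_proj_id X u : X \in K -> u \in trace X / D -> val (frame_proj X) u = u.
Proof.
move=> KX Tu; rewrite val_frame_proj //.
exact: central_proj_id derQ (cotrace_cent KX) (trace_mul_cotrace KX)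
  (der_sub_cotrace X) u Tu.
Qed.

Lemma frame_proj1 X Y u : X \in K -> Y \in K -> Y != X -> u \in trace Y / D ->
  val (frame_proj X) u = 1.
Proof.
move=> KX KY neqYX Tu; rewrite val_frame_proj //.
apply: (central_proj1 derQ (cotrace_cent KX) (trace_mul_cotrace KX) (der_sub_cotrace X)).
by apply: subsetP Tu; apply/quotientS/trace_sub_cotrace.
Qed.

Lemma frame_proj_orth X Y : X \in K -> Y \in K -> X != Y ->
  (frame_proj X * frame_proj Y = 0)%R.
Proof.
move=> KX KY neqXY; apply: val_inj; apply: eq_end_trace => [||T u KT Tu].
- exact: Adj_end (valP _).
- exact: Adj_end (valP _).
rewrite adj_mul_val adj_zero_val !ffunE.
have [eqTX|neqTX] := eqVneq T X.
  rewrite eqTX in Tu; apply: etrans (congr1 (val (frame_proj Y)) (frame_proj_id KX Tu)) _.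
  exact: frame_proj1 KY KX neqXY Tu.
apply: etrans (congr1 (val (frame_proj Y)) (frame_proj1 KX KT neqTX Tu)) _.
exact: is_end1 (frame_proj_end Y).
Qed.

Lemma frame_proj_sum : (\sum_(X in K) frame_proj X = 1)%R.
Proof.
apply: val_inj; apply: eq_end_trace => [||T u KT Tu].
- exact: Adj_end (valP _).
- exact: Adj_end (valP _).
have Vu : u \in V by apply: subsetP Tu; apply/quotientS/sub_trace.
rewrite (big_setD1 T KT) adj_add_val [LHS]ffunE adj_one_val [RHS]ffunE Vu.
rewrite frame_proj_id // adj_sum_val big1 ?mulg1 // => X /setD1P[neqXT KX].
by apply: (frame_proj1 KX KT) Tu; rewrite eq_sym.
Qed.

(** A symmetric idempotent [g] below [e] splits the trace of [X] into a fixed part [M1] and a kernel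
    [M2], which commute. Intersecting [X] with [M1 * Z] and [M2 * Z] gives a central factorization
    of [X], so one factor is [X], and [g] is [e] or 0 accordingly. *)
Lemma frame_proj_primitive X : X \in K ->
  star_primitive (adj_star derQ) (frame_proj X).
Proof.
move=> KX; pose e := frame_proj X.
have [SX notZX] := KpartP _ _ _ KX.
have NQ x : x \in Q -> x \in 'N(D) := subsetP (der_norm 1 Q) x.
have X_trace x : x \in X -> exists q z, [/\ q \in trace X, z \in Z & x = q * z].
  move=> Xx; have [q [z [Qq Zz def_x]]] := P_QZ (subsetP (sKP KX) x Xx).
  exists q, z; split=> //; apply: (@mem_trace X x z^-1); rewrite ?groupV //.
  by rewrite def_x mulgK.
split.
- move=> e0; case/negP: notZX; apply/subsetP=> x /X_trace[q [z [Tq Zz ->]]].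
  have Tqq : coset D q \in trace X / D by apply: mem_quotient.
  have := frame_proj_id KX Tqq; rewrite e0 adj_zero_val ffunE => /esym/coset_idr Dq.
  by rewrite groupM // (subsetP sDZ) // Dq // NQ // (subsetP (sub_trace X)).
- apply: adj_eq => u _; rewrite adj_mul_val ffunE.
  exact: frame_proj_id KX (frame_proj_mem u KX).
- exact/adj_starE/frame_proj_adjoint.
move=> g gg sg eg ge; pose f := val g.
have endf : is_end f := Adj_end (valP g).
have ff u : f (f u) = f u.
  by have := congr1 (fun h : R => val h u) gg; rewrite adj_mul_val ffunE.
have fe u : f (val e u) = f u.
  by have := congr1 (fun h : R => val h u) eg; rewrite adj_mul_val ffunE.
have ef u : val e (f u) = f u.
  by have := congr1 (fun h : R => val h u) ge; rewrite adj_mul_val ffunE.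
have adjf : is_adjoint f f by have := adj_starP g; rewrite sg.
have fT u : f u \in trace X / D by rewrite -ef frame_proj_mem.
have [fM _ _] := is_endP _ endf.
pose E1 := [set x in trace X | f (coset D x) == coset D x].
pose E2 := [set x in trace X | f (coset D x) == 1].
have TQ x : x \in trace X -> x \in Q := subsetP (sub_trace X) x.
have group1E : group_set E1.
  apply/group_setP; split=> [|x y].
    by apply/setIdP; rewrite group1 morph1 is_end1 ?eqxx.
  move=> /setIdP[Tx /eqP fx] /setIdP[Ty /eqP fy]; apply/setIdP.
  by rewrite groupM // morphM ?NQ ?TQ // fM ?mem_quotient ?TQ // fx fy eqxx.
have group2E : group_set E2.
  apply/group_setP; split=> [|x y].
    by apply/setIdP; rewrite group1 morph1 is_end1 ?eqxx.
  move=> /setIdP[Tx /eqP fx] /setIdP[Ty /eqP fy]; apply/setIdP.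
  by rewrite groupM // morphM ?NQ ?TQ // fM ?mem_quotient ?TQ // fx fy mulg1 eqxx.
pose M1 := Group group1E; pose M2 := Group group2E.
have M1P x : (x \in M1) = (x \in trace X) && (f (coset D x) == coset D x).
  by rewrite [LHS]in_set.
have M2P x : (x \in M2) = (x \in trace X) && (f (coset D x) == 1).
  by rewrite [LHS]in_set.
clearbody M1 M2.
have sM1P : M1 \subset P.
  by apply/subsetP=> x; rewrite M1P => /andP[/TQ/(subsetP sQP)].
have sM2P : M2 \subset P.
  by apply/subsetP=> x; rewrite M2P => /andP[/TQ/(subsetP sQP)].
pose H1 := (X :&: (M1 <*> Z))%G; pose H2 := (X :&: (M2 <*> Z))%G.
(* As [g] is self-adjoint, moving it from a fixed vector to a kernel vector shows that their form
   value is trivial. *)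
have cM12 : M1 \subset 'C(M2).
  apply/centsP=> x; rewrite M1P => /andP[Tx /eqP fx] y; rewrite M2P => /andP[Ty /eqP fy].
  apply/commgP/eqP; rewrite -(BiE derQ) ?TQ // -fx.
  have [_ _ ->] := is_adjointP _ _ adjf; rewrite ?mem_quotient ?TQ //.
  by rewrite fy (Bi1r derQ) // mem_quotient ?TQ.
have cZP (G : {group gT}) : G \subset P -> Z \subset 'C(G).
  by move=> sGP; rewrite (subset_trans (subsetIr P 'C(P))) ?centS.
have cH12 : H1 \subset 'C(H2).
  apply: subset_trans (subsetIr _ _) _; apply: subset_trans (centS (subsetIr _ _)).
  rewrite join_subG centsC join_subG centsC cM12 cZP //= cZP //.
  by rewrite join_subG sM2P center_sub.
have defX : H1 <*> H2 = X.
  apply/eqP; rewrite eqEsubset join_subG !subsetIl /=.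
  apply/subsetP=> x Xx; have [q [z [Tq Zz def_x]]] := X_trace x Xx.
  (* [m1] represents the image of [q] under [g]; idempotence puts [m1] in [M1] and [m1^-1 * q] in
     [M2]. *)
  have /morphimP[m1 Nm1 Tm1 fq] := fT (coset D q).
  have Tm2 : m1^-1 * q \in trace X by rewrite groupM ?groupV.
  have M1m1 : m1 \in M1 by rewrite M1P Tm1 -fq ff eqxx.
  have M2m2 : m1^-1 * q \in M2.
    rewrite M2P Tm2 morphM ?groupV ?NQ ?TQ // morphV ?NQ ?TQ //.
    rewrite fM ?groupV ?mem_quotient ?TQ // is_endV ?mem_quotient ?TQ //.
    by rewrite -fq ff fq mulVg eqxx.
  have [h1 [z1 [Xh1 Zz1 def_m1]]] := trace_decomp KX Tm1.
  have [h2 [z2 [Xh2 Zz2 def_m2]]] := trace_decomp KX Tm2.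
  have Hh1 : h1 \in H1.
    apply/setIP; split=> //; have -> : h1 = m1 * z1^-1 by rewrite def_m1 mulgK.
    apply: groupM; first exact: (subsetP (joing_subl _ _)).
    by rewrite groupV; apply: (subsetP (joing_subr _ _)).
  have Hh2 : h2 \in H2.
    apply/setIP; split=> //; have -> : h2 = m1^-1 * q * z2^-1 by rewrite def_m2 mulgK.
    apply: groupM; first exact: (subsetP (joing_subl _ _)).
    by rewrite groupV; apply: (subsetP (joing_subr _ _)).
  (* Passing between traces and members leaves a central error, which is absorbed in [H1] because
     [X :&: Z] lies in it. *)
  have Zx : (h1 * h2)^-1 * x \in Z.
    have -> : (h1 * h2)^-1 * x = h2^-1 * z1 * h2 * z2 * z.
      by rewrite def_x -(mulKVg m1 q) def_m2 {1}def_m1 invMg !mulgA mulgKV.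
    have Ph2 := subsetP (sKP KX) h2 Xh2.
    have -> : h2^-1 * z1 * h2 = z1 by rewrite -mulgA -(cent_Z Ph2 Zz1) mulKg.
    by rewrite !groupM.
  have H1x : (h1 * h2)^-1 * x \in H1.
    apply/setIP; split; first by rewrite !groupM ?groupV ?groupM.
    exact: (subsetP (joing_subr _ _)).
  rewrite -(mulKVg (h1 * h2) x); apply: groupM.
    apply: groupM; first exact: (subsetP (joing_subl H1 H2)).
    exact: (subsetP (joing_subr H1 H2)).
  exact: (subsetP (joing_subl H1 H2)).
(* Two elements of [Q] that agree modulo [Z(P)] agree modulo [D], so [M] represents every class of
   the trace. *)
have cosetM (M : {group gT}) q : M \subset Q -> X \subset M <*> Z -> q \in trace X ->
    exists2 m, m \in M & coset D q = coset D m.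
  move=> sMQ sXMZ Tq; have [x [z [Xx Zz def_q]]] := trace_decomp KX Tq.
  have := subsetP sXMZ x Xx; rewrite joinZ ?(subset_trans sMQ) //.
  case/mulsgP=> m t Mm Zt def_x; exists m => //.
  have Qm := subsetP sMQ m Mm; have Qq := TQ q Tq.
  have Dmq : m^-1 * q \in D.
    apply: QZ_D; first by rewrite groupM ?groupV.
    by rewrite def_q def_x -mulgA mulKg groupM.
  have Ndq : m^-1 * q \in 'N(D) by apply: NQ; rewrite groupM ?groupV.
  by rewrite -{1}(mulKVg m q) (morphM (coset_morphism D) (NQ m Qm) Ndq) /= (coset_id Dmq) mulg1.
have sM1Q : M1 \subset Q by apply/subsetP=> x; rewrite M1P => /andP[/TQ].
have sM2Q : M2 \subset Q by apply/subsetP=> x; rewrite M2P => /andP[/TQ].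
have [eqH|eqH] := indecomposable_joing (refined_indecomposable refS SX) cH12 defX.
  right; apply: adj_eq => u Vu; rewrite -/f -/e -fe.
  have [q Tq euq] : exists2 q, q \in trace X & val e u = coset D q.
    by have /morphimP[q _ Tq ->] := frame_proj_mem u KX; exists q.
  have sX : X \subset M1 <*> Z by rewrite -{1}eqH subsetIr.
  have [m M1m eqm] := cosetM M1 q sM1Q sX Tq; rewrite euq eqm.
  by move: M1m; rewrite M1P => /andP[_ /eqP].
left; apply: adj_eq => u Vu; rewrite -/f -fe adj_zero_val ffunE.
have [q Tq euq] : exists2 q, q \in trace X & val e u = coset D q.
  by have /morphimP[q _ Tq ->] := frame_proj_mem u KX; exists q.
have sX : X \subset M2 <*> Z by rewrite -{1}eqH subsetIr.
have [m M2m eqm] := cosetM M2 q sM2Q sX Tq; rewrite euq eqm.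
by move: M2m; rewrite M2P => /andP[_ /eqP].
Qed.

Lemma frame_proj_star_frame : star_frame (adj_star derQ) K frame_proj.
Proof.
split; [exact: frame_proj_primitive | exact: frame_proj_orth | exact: frame_proj_sum].
Qed.

End Frame.

(** * Partition of the noncentral members by maximal *-ideals *)

Section KsetPartition.
Local Open Scope group_scope.
Variables (gT : finGroupType) (Q : {group gT}) (derQ : Q^`(1) = 'Z(Q)).
Variables (K : {set {group gT}}) (E : {group gT} -> adj_ring derQ).
Hypothesis frameE : star_frame (adj_star derQ) K E.
Hypothesis eprojE : forall X, X \in K -> eproj Q K X = val (E X).

Let preim_val (I : {set endT Q}) := [set x : adj_ring derQ | val x \in I].

Let mem_Kset I X : X \in Kset Q K I = (X \in K) && (E X \notin preim_val I).
Proof. by rewrite inE; case KX: (X \in K) => //=; rewrite inE -eprojE. Qed.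

(** If every idempotent of the frame were in [I], so would be their sum 1. *)
Lemma Kset_neq0 I : I \in max_star_ideals Q -> Kset Q K I != set0.
Proof.
move=> maxI'; have [_ _ sumE] := frameE.
have [idI I1 _] := max_star_idealP _ _ (max_star_ideal_of_mem derQ maxI').
have [I0 IB _ _ _] := star_idealP _ _ idI.
apply: contraNneq I1 => KI0; rewrite -sumE.
apply: (big_ind (fun x => x \in preim_val I)) => [||X KX].
- exact: I0.
- by move=> x y Ix Iy; rewrite -[y]GRing.opprK; apply: (IB) => //; rewrite -GRing.sub0r; apply: IB.
apply: contraT => notIX; have : X \in Kset Q K I by rewrite mem_Kset KX.
by rewrite KI0 inE.
Qed.

(** The idempotent of a common member would avoid two maximal *-ideals. An ideal is recovered from
    its preimage in the ring type because it is contained in [Adj Q]. *)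
Lemma Kset_disjoint I J :
  I \in max_star_ideals Q -> J \in max_star_ideals Q -> I != J ->
  [disjoint Kset Q K I & Kset Q K J].
Proof.
move=> maxI maxJ neqIJ; rewrite -setI_eq0; apply: contraNT neqIJ.
case/set0Pn=> X /setIP[]; rewrite !mem_Kset => /andP[KX notIX] /andP[_ notJX].
have [primE _ _] := frameE.
have eqIJ : preim_val I = preim_val J.
  apply: max_star_ideal_unique (primE X KX) _ _ notIX notJX.
    exact: max_star_ideal_of_mem.
  exact: max_star_ideal_of_mem.
have sAdj I' : I' \in max_star_ideals Q -> I' \subset Adj Q.
  by rewrite inE => /and3P[/andP[/and5P[]]].
have sub I1 I2 : I1 \in max_star_ideals Q -> preim_val I1 = preim_val I2 -> I1 \subset I2.
  move=> maxI1 eqI; apply/subsetP=> f If.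
  pose x : adj_ring derQ := exist (fun g => g \in Adj Q) f (subsetP (sAdj I1 maxI1) f If).
  by have : x \in preim_val I1; [rewrite inE | rewrite eqI inE].
by rewrite eqEsubset !sub.
Qed.

Lemma Kset_cover : K = \bigcup_(I in max_star_ideals Q) Kset Q K I.
Proof.
have [primE _ _] := frameE.
apply/setP=> X; apply/idP/bigcupP=> [KX|[I _]]; last by rewrite mem_Kset => /andP[].
have [e_neq0 ee _ _] := primE X KX.
have [I maxI notIX] := exists_max_star_ideal (adj_star derQ) e_neq0 ee.
exists [set val x | x in I]; first exact: mem_max_star_ideals.
by rewrite mem_Kset KX inE mem_imset //; apply: val_inj.
Qed.

End KsetPartition.

(** * The idempotents [e_H] as members of the frame, and the inverse of 2 *)

Section Eproj.
Local Open Scope group_scope.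
Variables (gT : finGroupType) (p : nat) (P : {group gT}).
Hypotheses (pP : p.-group P) (expP : exponent P %| p) (clP : P^`(1) \subset 'Z(P)).
Variable S : {set {group gT}}.
Hypothesis refS : fully_refined P S.
Local Notation Q := (Qgroup P S).
Local Notation K := (Kpart P S).
Local Notation D := Q^`(1).
Local Notation E := (frame_proj pP expP clP S refS).
Let derQ := Qgroup_center_der pP expP clP refS.

Lemma trace_quotient X : X \in K -> trace P S X / D = X / D.
Proof.
move=> KX; have sXQ := Kpart_sub KX.
have NQ x : x \in Q -> x \in 'N(D) := subsetP (der_norm 1 Q) x.
apply/eqP; rewrite eqEsubset; apply/andP; split; last first.
  by apply: quotientS; rewrite subsetI joing_subl.
apply/subsetP=> _ /morphimP[q Nq Tq ->] /=.
have [x [z [Xx Zz def_q]]] := trace_decomp refS KX Tq.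
have Qx := subsetP sXQ x Xx; have Qq := subsetP (sub_trace _ _ _) q Tq.
have Dz : z \in D.
  rewrite derQ (subsetP (Qgroup_center_sub refS)) // inE Zz andbT.
  have -> : z = x^-1 * q by rewrite def_q mulKg.
  by rewrite groupM ?groupV.
have -> : coset D q = coset D x.
  have Nz := NQ z (subsetP (der_sub 1 Q) z Dz).
  by rewrite def_q (morphM (coset_morphism D) (NQ x Qx) Nz) /= (coset_id Dz) mulg1.
exact: mem_quotient.
Qed.

(** The conditions in [is_proj] fix the values on all traces, so by [eq_end_trace] the map picked
    can only be the frame projection. *)
Lemma eproj_frame_proj X : X \in K -> eproj Q K X = val (E X).
Proof.
move=> KX; rewrite /eproj; case: pickP => [f /and3P[endf fX fK] /=|/(_ (val (E X)))/negP[]].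
  apply: (eq_end_trace pP expP clP refS refS endf (frame_proj_end _ _ _ _ _ _)) => Y u KY Tu.
  have Yu : u \in Y / D by rewrite -trace_quotient.
  have [eqYX|neqYX] := eqVneq Y X.
    rewrite eqYX in Tu Yu; rewrite (eqP (forall_inP fX u Yu)).
    exact/esym/(frame_proj_id pP expP clP refS refS KX Tu).
  rewrite (eqP (forall_inP (implyP (forall_inP fK Y KY) neqYX) u Yu)).
  exact/esym/(frame_proj1 pP expP clP refS refS KX KY neqYX Tu).
apply/and3P; split; first exact: frame_proj_end.
  apply/forall_inP=> u Xu; apply/eqP.
  by apply: (frame_proj_id pP expP clP refS refS KX); rewrite trace_quotient.
apply/forall_inP=> Y KY; apply/implyP=> neqYX; apply/forall_inP=> u Yu; apply/eqP.
by apply: (frame_proj1 pP expP clP refS refS KX KY neqYX); rewrite trace_quotient.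
Qed.

(** For odd [p] the doubled half is [p.+1], and raising to this power is the identity in exponent
    [p]. *)
Lemma adj_ring_half : odd p -> ((p.+1)./2.*2%:R = 1 :> adj_ring derQ)%R.
Proof.
move=> odd_p; apply: adj_eq => u Vu.
rewrite adj_nat_val // adj_one_val ffunE Vu even_halfK /= ?odd_p //.
case/Vq_coset: Vu => q Qq ->; rewrite expgS.
have Nq : q \in 'N(D) := subsetP (der_norm 1 Q) q Qq.
rewrite -morphX // (_ : q ^+ p = 1) ?morph1 ?mulg1 //.
apply/eqP; rewrite -order_dvdn (dvdn_trans (dvdn_exponent _) expP) //.
by rewrite (subsetP (sub_Qgroup refS)).
Qed.

End Eproj.

Local Open Scope group_scope.

Theorem theorem4p32 (gT : finGroupType) (p : nat) (P : {group gT})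
    (HH : {set {group gT}}) :
  prime p -> odd p -> p.-group P -> nil_class P = 2 -> exponent P = p ->
  fully_refined P HH ->
  let Z := Zpart P HH in
  let K := Kpart P HH in
  let Q := Qof P HH in
  [/\ (forall I, I \in max_star_ideals Q -> Kset Q K I != set0),
      (forall I J, I \in max_star_ideals Q -> J \in max_star_ideals Q ->
         I != J -> [disjoint Kset Q K I & Kset Q K J]),
      (forall I, I \in max_star_ideals Q -> [disjoint Z & Kset Q K I]),
      HH = Z :|: \bigcup_(I in max_star_ideals Q) Kset Q K I &
      (forall HH2 : {set {group gT}}, fully_refined P HH2 ->
         [/\ #|Zpart P HH2| = #|Z|, #|Kpart P HH2| = #|K| & #|HH2| = #|HH|])].
Proof.
move=> p_pr odd_p pP cl2 expP_eq refHH Z K Q.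
have clP : P^`(1) \subset 'Z(P) by rewrite -nil_class2 cl2.
have expP : exponent P %| p by rewrite expP_eq.
pose derQ := Qgroup_center_der pP expP clP refHH.
(* The ring is the one built from [HH], whatever [S] is, so that [card_frame] can compare two
   decompositions. *)
have frame S (refS : fully_refined P S) :
    star_frame (adj_star derQ) (Kpart P S) (frame_proj pP expP clP S refHH).
  exact: (frame_proj_star_frame pP expP clP refHH (S := S) refS).
have eprojE := eproj_frame_proj pP expP clP refHH.
have frameHH := frame HH refHH.
split.
- exact: Kset_neq0 frameHH eprojE.
- exact: Kset_disjoint frameHH eprojE.
- move=> I _; rewrite -setI_eq0; apply/eqP/setP=> X; rewrite !in_set.
  by case: (X \in HH); case: (X \subset 'Z(P)).
- rewrite -(Kset_cover frameHH eprojE); apply/setP=> X; rewrite !in_set.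
  by case: (X \in HH); case: (X \subset 'Z(P)).
move=> HH2 refHH2.
have cardK : #|Kpart P HH2| = #|K|.
  exact: (card_frame (adj_ring_half pP expP clP refHH odd_p) (frame HH2 refHH2) frameHH).
have cardZ : #|Zpart P HH2| = #|Z|.
  (* The orders of [Z(P)] and [P'] depend on [P] alone, and they determine the exponent in
     [card_Zpart]. *)
  apply/eqP; rewrite -(eqn_exp2l _ _ (prime_gt1 p_pr)) -(eqn_pmul2l (cardG_gt0 P^`(1))).
  by rewrite -(card_Zpart p_pr pP expP clP refHH2) -(card_Zpart p_pr pP expP clP refHH).
have card_parts (S : {set {group gT}}) : #|S| = (#|Zpart P S| + #|Kpart P S|)%N.
  rewrite -(cardsID (Zpart P S) S) (setIidPr _) //.
  by apply/subsetP=> X /setIdP[].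
by rewrite (card_parts HH2) (card_parts HH) cardK cardZ.
Qed.
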